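(* Let $G=(A\cup B,E)$ be a bipartite graph (with $E\subseteq A\times B$) whose vertices are partitioned into priceable vertices $V_p$ and fixed-price vertices $V_f$ with costs $c(v)\ge 0$, and suppose $V_p\subseteq A$. Consider the Stackelberg vertex cover pricing game with a single follower who buys a minimum-weight vertex cover of $G$. Then there is a polynomial-time algorithm computing a price function $p^*:V_p\to\mathbb{R}_{\ge0}$ maximizing the leader's revenue.
   Context: In Stackelberg vertex cover pricing (StackVC) with one follower, the leader assigns prices $p(v)\ge 0$ to priceable vertices $v\in V_p$; the weight of a vertex set $C$ is $\sum_{v\in C\cap V_f}c(v)+\sum_{v\in C\cap V_p}p(v)$; the follower chooses a minimum-weight vertex cover of $G$, breaking ties in favor of higher revenue for the leader; the leader's revenue is the sum of prices of priceable vertices in the chosen cover. (A vertex cover using only fixed-price vertices is assumed to exist.) *)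

(* Defs.v *)
From mathcomp Require Import all_boot all_order all_algebra.
From mathcomp Require Import reals.

Set Implicit Arguments.
Unset Strict Implicit.
Unset Printing Implicit Defensive.
Import Order.TTheory GRing.Theory Num.Theory.
Local Open Scope ring_scope.

(** * Stackelberg vertex cover pricing with one follower *)

Section StackVC.
Variables (R : realFieldType) (V : finType).
(* [e u v] means that uv is an edge; [e] need not be symmetric.  The fixed-price
   vertices are those outside [Vp]; [c] is irrelevant on [Vp], and a price
   function is irrelevant outside [Vp]. *)
Variables (e : rel V) (Vp : {set V}) (c : V -> R).

Definition vertex_cover (C : {set V}) : bool :=
  [forall u, forall v, e u v ==> (u \in C) || (v \in C)].

Definition cover_revenue (p : V -> R) (C : {set V}) : R :=
  \sum_(v in C :&: Vp) p v.

Definition cover_weight (p : V -> R) (C : {set V}) : R :=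
  \sum_(v in C :\: Vp) c v + cover_revenue p C.

Definition min_cover (p : V -> R) (C : {set V}) : Prop :=
  vertex_cover C /\
  forall D, vertex_cover D -> cover_weight p C <= cover_weight p D.

(* Ties are broken in favor of the leader. *)
Definition follower_choice (p : V -> R) (C : {set V}) : Prop :=
  min_cover p C /\
  forall D, min_cover p D -> cover_revenue p D <= cover_revenue p C.

Definition price_function (p : V -> R) : Prop := forall v, v \in Vp -> 0 <= p v.

(* The leader's revenue under [p] is [cover_revenue p C] for any follower
   choice [C]; follower choices exist for every [p] (see below), and all of them
   yield the same revenue. *)
Definition revenue_maximizing (p : V -> R) : Prop :=
  price_function p /\
  exists2 C, follower_choice p C &
    forall (q : V -> R) (D : {set V}), price_function q ->
      follower_choice q D -> cover_revenue q D <= cover_revenue p C.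

Lemma follower_choice_exists (p : V -> R) : exists C, follower_choice p C.
Proof.
have coverT : vertex_cover setT.
  by apply/forallP=> u; apply/forallP=> v; rewrite in_setT implybT.
case: (arg_minP (cover_weight p) coverT) => C0 C0cover C0min.
pose m C := vertex_cover C && (cover_weight p C == cover_weight p C0).
have mE C : m C <-> min_cover p C.
  split=> [/andP[Ccover /eqP wC]|[Ccover Cmin]]; first by split; rewrite // wC.
  by rewrite /m Ccover eq_le Cmin // C0min.
have mC0 : m C0 by rewrite /m C0cover eqxx.
case: (arg_maxP (cover_revenue p) mC0) => C mC Cmax.
by exists C; split=> [|D /mE]; [apply/mE | apply: Cmax].
Qed.

End StackVC.

(** * Bipartite instances *)

(* For inputs of an algorithm the two sides are numbered and the fixed costs
   are rational. *)
Record bip_instance := BipInstance {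
  nA : nat;
  nB : nat;
  edges : {set 'I_nA * 'I_nB};
  priceable : {set 'I_nA + 'I_nB};
  cost : 'I_nA + 'I_nB -> rat
}.

Definition vertex (I : bip_instance) : finType := ('I_(nA I) + 'I_(nB I))%type.

Definition sideA (I : bip_instance) : {set vertex I} :=
  [set u : vertex I | if u is inl _ then true else false].

Definition adj (I : bip_instance) : rel (vertex I) := fun u v =>
  match u, v with inl i, inr j => (i, j) \in edges I | _, _ => false end.
Arguments adj : clear implicits.

(* The standing assumption that some vertex cover uses only fixed-price vertices
   is automatic when all priceable vertices lie in A. *)
Lemma fixed_price_cover_exists (I : bip_instance) :
  priceable I \subset sideA I ->
  exists C, vertex_cover (adj I) C /\ [disjoint C & priceable I].
Proof.
move=> sub; exists (~: sideA I); split.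
  by apply/forallP=> -[i|i]; apply/forallP=> -[j|j]; rewrite !inE //= implybT.
by rewrite disjoint_sym disjoints_subset setCK.
Qed.

(** * Encodings as sequences of integers *)

Definition encode_vertex (I : bip_instance) (v : vertex I) : seq int :=
  if v \in priceable I then [:: 1] else [:: 0; numq (cost v); denq (cost v)].

(* The sizes of A and B, the vertices of A, those of B, the adjacency matrix
   row by row. *)
Definition encode (I : bip_instance) : seq int :=
  [:: (nA I)%:Z; (nB I)%:Z]
  ++ flatten [seq encode_vertex (inl i : vertex I) | i <- enum 'I_(nA I)]
  ++ flatten [seq encode_vertex (inr j : vertex I) | j <- enum 'I_(nB I)]
  ++ [seq (((i, j) \in edges I) : nat)%:Z
       | i <- enum 'I_(nA I), j <- enum 'I_(nB I)].

(* One fraction per priceable vertex, not necessarily in lowest terms. *)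
Definition encodes_prices (I : bip_instance) (p : vertex I -> rat)
    (y : seq int) : Prop :=
  exists num den : vertex I -> int,
    (forall v, v \in priceable I ->
       0 < den v /\ p v = (num v)%:~R / (den v)%:~R) /\
    y = flatten [seq [:: num v; den v] | v <- enum (priceable I)].

(* Number of binary digits. *)
Definition bit_length (z : int) : nat := (trunc_log 2 `|z|).+1.

Definition input_size (x : seq int) : nat := \sum_(z <- x) bit_length z.

(** * Random access machines *)

(* The instruction set of Cook and Reckhow ("Time bounded random access
   machines"), with registers indexed by int so that an indirect address is
   always legal.  Every instruction takes one step.  Addition and subtraction
   are the only arithmetic operations, so a step lengthens the largest register
   by at most one bit, and polynomial time, as a function of the bit size of the
   input, agrees with polynomial time on Turing machines. *)
Inductive instr :=
| Const of int & int        (* X_d := z *)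
| Add of int & int & int    (* X_d := X_i + X_j *)
| Sub of int & int & int    (* X_d := X_i - X_j *)
| LoadInd of int & int      (* X_d := X_(X_i) *)
| StoreInd of int & int     (* X_(X_d) := X_i *)
| JumpPos of int & nat      (* go to instruction l if X_i > 0 *)
| Read of int               (* X_d := next input, 0 if there is none *)
| Write of int.             (* append X_i to the output *)

Definition program := seq instr.

Record state := State {
  pc : nat;
  reg : int -> int;
  inp : seq int;
  out : seq int
}.

Definition set_reg (r : int -> int) (d z : int) : int -> int :=
  fun i => if i == d then z else r i.

Definition exec (a : instr) (s : state) : state :=
  let: State n r x y := s in
  match a with
  | Const d z => State n.+1 (set_reg r d z) x y
  | Add d i j => State n.+1 (set_reg r d (r i + r j)) x y
  | Sub d i j => State n.+1 (set_reg r d (r i - r j)) x y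
  | LoadInd d i => State n.+1 (set_reg r d (r (r i))) x y
  | StoreInd d i => State n.+1 (set_reg r (r d) (r i)) x y
  | JumpPos i l => State (if 0 < r i then l else n.+1) r x y
  | Read d => State n.+1 (set_reg r d (head 0 x)) (behead x) y
  | Write i => State n.+1 r x (rcons y (r i))
  end.

(* The machine halts when the program counter leaves the program. *)
Definition step (P : program) (s : state) : state :=
  if onth P (pc s) is Some a then exec a s else s.

Definition init (x : seq int) : state := State 0 (fun=> 0) x [::].

Definition halts_within (P : program) (x : seq int) (t : nat) (y : seq int) :
    Prop :=
  let s := iter t (step P) (init x) in (size P <= pc s)%N /\ out s = y.

(* Main.v *)
(* Let W(x) be the least weight of a vertex cover when all priceable vertices
   cost x.  For any prices the follower pays at most W(oo), of which at least
   W(0) goes to fixed-price vertices, so the revenue is at most W(oo) - W(0).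
   By duality both numbers are values of maximum flows in the network
   source -> A -> B -> sink.  Compute a maximum flow in which priceable vertices
   receive no supply, then augment it to a maximum flow in which their supply
   is unlimited.  Augmenting never decreases the flow on an arc leaving the
   source, so the fixed-price vertices of A still carry W(0), and pricing each
   priceable vertex at the flow through it attains the bound.

   Costs are first multiplied by a common denominator.  The flows are found by
   scaling: when no augmenting path of capacity D is left, some cut has
   residual capacity at most m^2 (D - 1), m being the number of vertices of the
   network, and each augmentation by D/2 lowers it by D/2, so that polynomially
   many augmentations suffice for the next scale.

   The running time is controlled syntactically.  The algorithm is written in a
   structured language in which every loop runs [bound] times, for a number
   [bound] that only ever grows, so the time is at most a polynomial, read off
   the program, in the final value of [bound]; this value is linear in the size
   of the input. *)

Require Import Defs.
From mathcomp Require Import all_boot all_order all_algebra.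
From mathcomp Require Import reals.
From mathcomp Require boolp.
From mathcomp Require Import zify lra.
Set Implicit Arguments.
Unset Strict Implicit.
Unset Printing Implicit Defensive.
Import Order.TTheory GRing.Theory Num.Theory.
Local Open Scope ring_scope.

(** Two restrictions shape the proof. The machine can neither multiply nor divide, so powers of two
    and row offsets are tabulated, and the scale D is read from the table of powers from the top
    down instead of being halved. And no loop can be left early: a loop idles once its work is done,
    so it is enough to show that the useful passes never outnumber the passes made.

    No flow is ever stored. The only data is the residual matrix, and [flow_le] says that one matrix
    arises from another by a flow. This relation is transitive, so it survives any number of
    augmentations, and the flow on an arc is read off the reverse arc.

    Infinite capacity is represented by one plus the sum of the capacities of B. All flow has to
    leave through the arcs from B to the sink, so an arc of that capacity is never saturated and
    crosses no cut of residual capacity 0.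

    Optimality is phrased as a certificate: inequalities between one fractional matching and two
    vertex covers. They hold over any ordered field, which is why rational prices are optimal among
    real ones. *)

(** * The structured language and its semantics *)

Record store := Store {
  cell : nat -> int -> int;
  bound : nat;
  input : seq int;
  output : seq int
}.

Inductive exp :=
| Cst of int
| Bound
| Get of nat & exp
| Plus of exp & exp
| Minus of exp & exp.

(* [Grow e] adds the number of binary digits of [e] to the loop bound; scalar
   variables are arrays used at index 0 only. *)
Inductive cmd :=
| Skip
| Put of nat & exp & exp
| Seq of cmd & cmd
| If of exp & cmd & cmd
| Loop of cmd
| Input of nat & exp
| Output of exp
| AddBound of exp
| Grow of exp.

Definition upd (m : nat -> int -> int) (a : nat) (i z : int) : nat -> int -> int :=
  fun b => if b == a then fun j => if j == i then z else m b j else m b.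

Definition put a i z s := Store (upd (cell s) a i z) (bound s) (input s) (output s).

Fixpoint eval (s : store) (e : exp) : int :=
  match e with
  | Cst z => z
  | Bound => (bound s)%:Z
  | Get a e => cell s a (eval s e)
  | Plus e f => eval s e + eval s f
  | Minus e f => eval s e - eval s f
  end.

Definition pos_part (z : int) : nat := if 0 < z then `|z|%N else 0%N.

Fixpoint sem (c : cmd) (s : store) : store :=
  match c with
  | Skip => s
  | Put a e f => put a (eval s e) (eval s f) s
  | Seq c d => sem d (sem c s)
  | If e c d => if 0 < eval s e then sem c s else sem d s
  | Loop c => iter (bound s) (sem c) s
  | Input a e =>
      Store (upd (cell s) a (eval s e) (head 0 (input s)))
        (bound s) (behead (input s)) (output s)
  | Output e => Store (cell s) (bound s) (input s) (rcons (output s) (eval s e))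
  | AddBound e =>
      Store (cell s) (bound s + pos_part (eval s e))%N (input s) (output s)
  | Grow e =>
      Store (cell s) (bound s + up_log 2 (pos_part (eval s e)))%N
        (input s) (output s)
  end.

(** * Compilation to random access machines *)

(* Cell i of array a lives in register 2^(a+1) (2 i + 1); the odd registers
   are free for temporaries, register 1 holding the loop bound. *)
Definition double (z : int) := z + z.
Definition addr (a : nat) (i : int) : int := iter a.+1 double (i + i + 1).
Definition tmp (d : nat) : int := d%:Z + d%:Z + 1.

(** The exponent of two in an address determines the array and the odd part determines the index,
    negative indices included. *)
Lemma addr_inj a b i j : addr a i = addr b j -> a = b /\ i = j.
Proof.
have dbl_inj x y : double x = double y -> x = y by rewrite /double; lia.
have odd_dbl x y : x + x + 1 <> double y by rewrite /double; lia.
rewrite /addr; elim: a b => [|a IH] [|b]; rewrite ?[iter _.+2 _ _]iterS ?[iter 1 _ _]/=;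
  move=> /dbl_inj.
- by split=> //; lia.
- by rewrite iterS => /odd_dbl.
- by rewrite iterS => /esym/odd_dbl.
by case/IH=> -> ->.
Qed.

Lemma addr_tmp a i d : addr a i <> tmp d.
Proof. by rewrite /addr /tmp iterS /double; lia. Qed.

Lemma tmp_inj d d' : tmp d = tmp d' -> d = d'.
Proof. by rewrite /tmp; lia. Qed.

(** Three instructions form 2 i + 1, and the remaining ones double it. The lock keeps simplification
    from unfolding the instruction list. *)
Definition addr_code (a d : nat) : program :=
  locked
    ([:: Add (tmp d) (tmp d) (tmp d); Const (tmp d.+1) 1;
         Add (tmp d) (tmp d) (tmp d.+1)]
     ++ nseq a.+1 (Add (tmp d) (tmp d) (tmp d))).

Arguments addr : simpl never.

Definition code_at (P : program) (o : nat) (p : program) :=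
  forall i, (i < size p)%N -> onth P (o + i) = onth p i.

Lemma code_at_cat P o p q :
  code_at P o (p ++ q) <-> code_at P o p /\ code_at P (o + size p) q.
Proof.
split=> [H|[Hp Hq] i].
  split=> i lt_i.
    by rewrite H ?size_cat ?ltn_addr // onth_cat lt_i.
  by rewrite -addnA H ?size_cat ?ltn_add2l // onth_cat ltnNge leq_addr addKn.
rewrite size_cat onth_cat; case: (ltnP i (size p)) => [lt_i _|le_i lt_i]; first exact: Hp.
by rewrite -Hq ?ltn_subLR // -addnA subnKC.
Qed.

Lemma code_at_cons P o a q :
  code_at P o (a :: q) <-> onth P o = Some a /\ code_at P o.+1 q.
Proof.
rewrite -cat1s code_at_cat /= addn1; split=> -[H ?]; split=> //.
  by rewrite -[o]addn0 H.
by case=> // _; rewrite addn0.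
Qed.

Definition simple (a : instr) : bool :=
  match a with
  | Const _ _ | Add _ _ _ | Defs.Sub _ _ _ | LoadInd _ _ | StoreInd _ _ => true
  | _ => false
  end.

Definition exec_reg (r : int -> int) (a : instr) : int -> int :=
  reg (exec a (State 0 r [::] [::])).

Lemma run_simple P p r x y o :
  code_at P o p -> all simple p ->
  iter (size p) (step P) (State o r x y)
  = State (o + size p) (foldl exec_reg r p) x y.
Proof.
elim: p o r => [|a p IH] o r; first by rewrite addn0.
move=> /code_at_cons[Ha Hp] /= /andP[sa sp]; rewrite -iterS iterSr.
suff ->: step P (State o r x y) = State o.+1 (exec_reg r a) x y.
  by rewrite IH // addSnnS.
by rewrite /step /= Ha; case: a sa {Ha}.
Qed.

Lemma simple_addr a d : all simple (addr_code a d).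
Proof. by rewrite /addr_code -lock all_cat all_nseq orbT. Qed.

Lemma set_regE r d z i : set_reg r d z i = if i == d then z else r i.
Proof. by []. Qed.

Lemma tmp_eq d d' : (tmp d == tmp d') = (d == d').
Proof. by apply/eqP/eqP => [/tmp_inj|->]. Qed.

Lemma addr_tmpF a i d : (addr a i == tmp d) = false.
Proof. by apply/eqP/addr_tmp. Qed.

Lemma neq_succ d :
  ((d == d.+1) = false) * ((d.+1 == d) = false) * ((d == d.+2) = false)
  * ((d.+2 == d) = false) * ((d == d.+3) = false) * ((d.+3 == d) = false).
Proof. by do !split; apply/eqP; lia. Qed.

Definition regE := (tmp_eq, addr_tmpF, eqSS, eqxx, neq_succ).

Definition eq_below (d : nat) (r r' : int -> int) :=
  (forall j, (j < d)%N -> r' (tmp j) = r (tmp j)) /\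
  (forall a i, r' (addr a i) = r (addr a i)).

Lemma eq_below_trans d d' r r' r'' :
  (d <= d')%N -> eq_below d r r' -> eq_below d' r' r'' -> eq_below d r r''.
Proof.
move=> le_d [T1 A1] [T2 A2]; split=> [j lt_j|a i]; last by rewrite A2.
by rewrite T2 ?T1 // (leq_trans lt_j).
Qed.

Lemma eq_below_set d d' r r' z :
  (d <= d')%N -> eq_below d r r' -> eq_below d r (set_reg r' (tmp d') z).
Proof.
move=> le_d [T A]; split=> [j lt_j|a i]; rewrite set_regE.
  by rewrite tmp_eq ltn_eqF ?(leq_trans lt_j) // T.
by rewrite addr_tmpF A.
Qed.

Lemma eq_below_refl d r : eq_below d r r. Proof. by []. Qed.
#[local] Hint Resolve eq_below_refl : core.

Lemma addr_code_correct a d r :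
  let r' := foldl exec_reg r (addr_code a d) in
  r' (tmp d) = addr a (r (tmp d)) /\ eq_below d r r'.
Proof.
rewrite /addr_code -lock foldl_cat.
set r1 := foldl _ _ [:: _; _; _].
have r1d : r1 (tmp d) = r (tmp d) + r (tmp d) + 1.
  by rewrite /r1 /exec_reg /= /set_reg !regE.
have : eq_below d r r1.
  by do ?[apply: eq_below_set => //=].
rewrite /addr -r1d; move: (a.+1) r1 {r1d} => k r1 E1.
elim: k => [//|k [IHk IHE]].
rewrite -addn1 nseqD foldl_cat addn1 iterS /= /exec_reg /= set_regE eqxx.
by rewrite IHk; split=> //; apply: eq_below_set.
Qed.

Lemma size_addr_code a d : size (addr_code a d) = (a + 4)%N.
Proof. by rewrite /addr_code -lock size_cat size_nseq addnC addSnnS. Qed.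

Fixpoint exp_code (e : exp) (d : nat) : program :=
  match e with
  | Cst z => [:: Const (tmp d) z]
  | Bound => [:: Const (tmp d) 0; Add (tmp d) (tmp d) (tmp 0)]
  | Get a e => exp_code e d ++ addr_code a d ++ [:: LoadInd (tmp d) (tmp d)]
  | Plus e f =>
      exp_code e d ++ exp_code f d.+1 ++ [:: Add (tmp d) (tmp d) (tmp d.+1)]
  | Minus e f =>
      exp_code e d ++ exp_code f d.+1 ++ [:: Defs.Sub (tmp d) (tmp d) (tmp d.+1)]
  end.

Definition jump (d l : nat) : program := [:: Const (tmp d) 1; JumpPos (tmp d) l].

(* Code for [c], loaded at position [o] and using temporaries from [d] on. *)
Fixpoint code (c : cmd) (d o : nat) : program :=
  match c with
  | Skip => [::]
  | Put a e f =>
      (exp_code e d ++ addr_code a d ++ exp_code f d.+1)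
      ++ [:: StoreInd (tmp d) (tmp d.+1)]
  | Seq c1 c2 =>
      let p1 := code c1 d o in p1 ++ code c2 d (o + size p1)
  | If e c1 c2 =>
      let p := exp_code e d in
      let o2 := (o + size p + 1)%N in
      let p2 := code c2 d o2 in
      let o1 := (o2 + size p2 + 2)%N in
      let p1 := code c1 d o1 in
      p ++ [:: JumpPos (tmp d) o1] ++ p2 ++ jump d (o1 + size p1) ++ p1
  | Loop c =>
      let p := code c d.+1 (o + 4) in
      exp_code Bound d ++ jump d.+1 (o + 4 + size p + 2)
      ++ p ++ [:: Const (tmp d.+1) 1; Defs.Sub (tmp d) (tmp d) (tmp d.+1);
                  JumpPos (tmp d) (o + 4)]
  | Input a e =>
      (exp_code e d ++ addr_code a d)
      ++ [:: Read (tmp d.+1); StoreInd (tmp d) (tmp d.+1)]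
  | Output e => exp_code e d ++ [:: Write (tmp d)]
  | AddBound e =>
      let p := exp_code e d in
      p ++ [:: JumpPos (tmp d) (o + size p + 2); Const (tmp d) 0;
               Add (tmp 0) (tmp 0) (tmp d)]
  | Grow e =>
      let p := exp_code e d in
      p ++ Const (tmp d.+1) 1 :: jump d.+2 (o + size p + 5)
      ++ [:: Add (tmp d.+1) (tmp d.+1) (tmp d.+1); Add (tmp 0) (tmp 0) (tmp d.+2);
             Defs.Sub (tmp d.+3) (tmp d) (tmp d.+1); JumpPos (tmp d.+3) (o + size p + 3)]
  end.

Lemma simple_exp e d : all simple (exp_code e d).
Proof.
elim: e d => //= [a e IH|e IHe f IHf|e IHe f IHf] d.
- by rewrite all_cat IH all_cat simple_addr.
- by rewrite !all_cat IHe IHf.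
- by rewrite !all_cat IHe IHf.
Qed.

Definition agree (s : store) (r : int -> int) :=
  (forall a i, r (addr a i) = cell s a i) /\ r (tmp 0) = (bound s)%:Z.

Lemma agree_below s d r r' :
  (0 < d)%N -> eq_below d r r' -> agree s r -> agree s r'.
Proof. by move=> d0 [T A] [M B]; split=> [a i|]; rewrite ?A ?T. Qed.

Lemma exp_code_correct s e d r :
  (0 < d)%N -> agree s r ->
  let r' := foldl exec_reg r (exp_code e d) in
  r' (tmp d) = eval s e /\ eq_below d r r'.
Proof.
elim: e d r => [z||a e IH|e IHe f IHf|e IHe f IHf] d r d0 sr /=; rewrite ?foldl_cat.
- by rewrite /exec_reg /= set_regE eqxx; split=> //; apply: eq_below_set.
- rewrite /exec_reg /= !set_regE eqxx tmp_eq ltn_eqF // add0r sr.2; split=> //.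
  by do 2?apply: eq_below_set.
- have [] := IH d r d0 sr; set r1 := foldl _ _ _ => v1 E1.
  have [] := addr_code_correct a d r1; set r2 := foldl _ _ (addr_code _ _) => v2 E2.
  rewrite /= /exec_reg /= set_regE eqxx v2 v1 E2.2 E1.2 sr.1; split=> //.
  by apply: eq_below_set => //; apply: eq_below_trans E2.
- have [] := IHe d r d0 sr; set r1 := foldl _ _ _ => v1 E1.
  have [] := IHf d.+1 r1 isT (agree_below d0 E1 sr).
  set r2 := foldl _ _ _ => v2 E2.
  rewrite /= /exec_reg /= set_regE eqxx v2 E2.1 // v1; split=> //.
  by apply: eq_below_set => //; apply: eq_below_trans E2.
have [] := IHe d r d0 sr; set r1 := foldl _ _ _ => v1 E1.
have [] := IHf d.+1 r1 isT (agree_below d0 E1 sr).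
set r2 := foldl _ _ _ => v2 E2.
rewrite /= /exec_reg /= set_regE eqxx v2 E2.1 // v1; split=> //.
by apply: eq_below_set => //; apply: eq_below_trans E2.
Qed.

(* [N] is the value of the loop bound at the end of the run. *)
Fixpoint time_bound (c : cmd) (N : nat) : nat :=
  match c with
  | Skip => 0
  | Seq c1 c2 => time_bound c1 N + time_bound c2 N
  | If e c1 c2 => size (exp_code e 0) + 3 + time_bound c1 N + time_bound c2 N
  | Loop c => 5 + N * (time_bound c N + 3)
  | Grow e => size (exp_code e 0) + 5 + N * 4
  | c => size (code c 0 0)
  end%N.

Lemma size_exp_code e d : size (exp_code e d) = size (exp_code e 0).
Proof.
suff H d' : size (exp_code e d) = size (exp_code e d') by [].
elim: e d d' => //= [a e IH|e IHe f IHf|e IHe f IHf] d d'.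
- by rewrite !size_cat !size_addr_code (IH d d').
- by rewrite !size_cat (IHe d d') (IHf d.+1 d'.+1).
- by rewrite !size_cat (IHe d d') (IHf d.+1 d'.+1).
Qed.

Lemma time_bound_mono c N N' : (N <= N')%N -> (time_bound c N <= time_bound c N')%N.
Proof.
move=> le_N; elim: c => //= [c IHc d IHd|e c IHc d IHd|c IHc|e].
- exact: leq_add.
- by rewrite !leq_add.
- by rewrite leq_add2l leq_mul // leq_add2r.
- by rewrite leq_add2l leq_mul2r le_N.
Qed.

Lemma bound_mono c s : (bound s <= bound (sem c s))%N.
Proof.
elim: c s => //= [c IHc d IHd|e c IHc d IHd|c IHc|e|e] s.
- exact: leq_trans (IHc _) (IHd _).
- by case: ifP.
- by elim: {2}(bound s) => //= k IHk; apply: leq_trans IHk (IHc _).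
- exact: leq_addr.
- exact: leq_addr.
Qed.

Definition reach P t st st' := iter t (step P) st = st'.

Lemma reach_trans P t t' a b c :
  reach P t a b -> reach P t' b c -> reach P (t + t') a c.
Proof. by rewrite /reach addnC iterD => -> . Qed.

Lemma reach_step P o a r x y st :
  onth P o = Some a -> exec a (State o r x y) = st -> reach P 1 (State o r x y) st.
Proof. by rewrite /reach /= /step /= => -> . Qed.

Lemma code_at1 P o a : code_at P o [:: a] <-> onth P o = Some a.
Proof. by split=> [/code_at_cons[]//|Ha]; apply/code_at_cons. Qed.

(** In contrast to [eq_below], register [tmp 0] is exempt, because commands may raise the loop bound
    stored there, and so are the array cells, which [agree] accounts for. *)
Definition keep d (r r' : int -> int) :=
  forall j, (0 < j < d)%N -> r' (tmp j) = r (tmp j).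

Lemma keep_below d d' r r' : (d <= d')%N -> eq_below d' r r' -> keep d r r'.
Proof. by move=> le_d [T _] j /andP[_ lt_j]; rewrite T // (leq_trans lt_j). Qed.

Lemma keep_trans d d' r r' r'' :
  (d <= d')%N -> keep d r r' -> keep d' r' r'' -> keep d r r''.
Proof.
move=> le_d K K' j /andP[j0 lt_j].
by rewrite K' ?K ?j0 // (leq_trans lt_j).
Qed.

Lemma keep_set_addr d r r' a i z :
  keep d r r' -> keep d r (set_reg r' (addr a i) z).
Proof. by move=> K j lt_j; rewrite set_regE eq_sym addr_tmpF K. Qed.

Lemma keep_set_bound d r r' z : keep d r r' -> keep d r (set_reg r' (tmp 0) z).
Proof.
move=> K j lt_j; rewrite set_regE tmp_eq gtn_eqF ?K //.
by case/andP: lt_j.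
Qed.

Lemma agree_set_bound s r z :
  agree s r ->
  agree (Store (cell s) z (input s) (output s)) (set_reg r (tmp 0) z%:Z).
Proof.
move=> [M B]; split=> [a i|]; rewrite /= set_regE ?eqxx //.
by rewrite addr_tmpF M.
Qed.

Lemma agree_put s r r' a i z d :
  (0 < d)%N -> agree s r -> eq_below d r r' ->
  agree (put a i z s) (set_reg r' (addr a i) z).
Proof.
move=> d0 sr E; have [M B] := agree_below d0 E sr.
split=> [b j|] /=; last by rewrite set_regE eq_sym addr_tmpF B.
rewrite set_regE /upd; case: eqP => [/addr_inj[-> ->]|ne]; first by rewrite !eqxx.
by case: (b =P a) ne => // ->; case: (j =P i) => // -> [].
Qed.

Lemma exp_addr_correct s e a d r :
  (0 < d)%N -> agree s r ->
  let r' := foldl exec_reg r (exp_code e d ++ addr_code a d) in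
  r' (tmp d) = addr a (eval s e) /\ eq_below d r r'.
Proof.
move=> d0 sr r0; rewrite {}/r0 foldl_cat.
have [] := exp_code_correct e d0 sr; set r1 := foldl _ _ _ => v1 E1.
have [] := addr_code_correct a d r1; set r2 := foldl _ _ _ => v2 E2.
by rewrite v2 v1; split=> //; apply: eq_below_trans E2.
Qed.

Lemma size_code_put a e f d o : size (code (Put a e f) d o) = time_bound (Put a e f) 0.
Proof.
by rewrite /= !size_cat !size_addr_code size_exp_code (size_exp_code f d.+1)
  (size_exp_code f 1).
Qed.

Lemma size_code_input a e d o : size (code (Input a e) d o) = time_bound (Input a e) 0.
Proof. by rewrite /= !size_cat !size_addr_code size_exp_code. Qed.

Lemma code_correct P c d o r s :
  (0 < d)%N -> code_at P o (code c d o) -> agree s r ->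
  exists t r', [/\ (t <= time_bound c (bound (sem c s)))%N,
    reach P t (State o r (input s) (output s))
      (State (o + size (code c d o)) r' (input (sem c s)) (output (sem c s))),
    agree (sem c s) r' & keep d r r'].
Proof.
elim: c d o r s => [|a e f|c IHc c' IHc'|e c IHc c' IHc'|c IHc|a e|e|e|e] d o r s d0.
- by exists 0%N, r; rewrite /= addn0.
- move=> Pc sr.
  exists (size (code (Put a e f) d o)).
  move: Pc; rewrite [code _ _ _]/= => Pc.
  have := Pc; rewrite code_at_cat => -[Pp /code_at1 Ps].
  have simp : all simple (exp_code e d ++ addr_code a d ++ exp_code f d.+1).
    by rewrite !all_cat simple_addr !simple_exp.
  have R := run_simple r (input s) (output s) Pp simp.
  move: R; rewrite [X in foldl _ _ X]catA foldl_cat.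
  have [] := exp_addr_correct e a d0 sr; set r1 := foldl _ _ _ => v1 E1.
  have [] := exp_code_correct f (ltn0Sn d) (agree_below d0 E1 sr).
  set r2 := foldl _ _ _ => v2 E2 R.
  exists (set_reg r2 (addr a (eval s e)) (eval s f)).
  have E12 : eq_below d r r2 by apply: eq_below_trans E2.
  split.
  + by move: (size_code_put a e f d o) => /= ->.
  + rewrite size_cat addnA /=; apply: reach_trans R _.
    by apply: reach_step Ps _; rewrite /= (E2.1 d) // v1 v2 addn1.
  + exact: agree_put E12.
  + by apply: keep_set_addr; apply: keep_below E12.
- rewrite /= => /code_at_cat[P1 P2] sr.
  have [t1 [r1 [le1 R1 A1 K1]]] := IHc _ _ _ _ d0 P1 sr.
  have [t2 [r2 [le2 R2 A2 K2]]] := IHc' _ _ _ _ d0 P2 A1.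
  exists (t1 + t2)%N, r2; split=> //; last exact: keep_trans K1 K2.
    by rewrite leq_add // (leq_trans le1) // time_bound_mono // bound_mono.
  by rewrite size_cat addnA; apply: reach_trans R1 R2.
- rewrite /=; set o2 := (o + _ + 1)%N; set o1 := (o2 + _ + 2)%N.
  move=> /code_at_cat[Pe /code_at_cons[Pj /code_at_cat[P2]]].
  move=> /code_at_cons[Pk /code_at_cons[Pl P1]] sr.
  have := run_simple r (input s) (output s) Pe (simple_exp e d).
  have [] := exp_code_correct e d0 sr; set r1 := foldl _ _ _ => v1 E1 R.
  have sr1 := agree_below d0 E1 sr.
  have eo2 : (o + size (exp_code e d)).+1 = o2 by rewrite /o2 addn1.
  have Rj : reach P 1 (State (o + size (exp_code e d)) r1 (input s) (output s))
              (State (if 0 < eval s e then o1 else o2) r1 (input s) (output s)).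
    by apply: reach_step Pj _; rewrite /= v1 eo2.
  case: ifP Rj => sg Rj.
    have eo1 : (o + size (exp_code e d)).+1 + size (code c' d o2) + 2 = o1 by rewrite eo2.
    move: P1; rewrite -!addSnnS addn0 eo2 => P1.
    have {}P1 : code_at P o1 (code c d o1) by rewrite {1}/o1 addn2.
    have [t2 [r2 [le2 R2 A2 K2]]] := IHc _ _ _ _ d0 P1 sr1.
    exists (size (exp_code e d) + 1 + t2)%N, r2; split=> //.
    + by rewrite (size_exp_code e d); lia.
    + rewrite !size_cat /= !size_cat /=.
      have -> : (o + (size (exp_code e d) + (size (code c' d o2) + (size (code c d o1)).+2).+1)
        = o1 + size (code c d o1))%N by rewrite /o1 /o2; lia.
      by apply: reach_trans R2; apply: reach_trans Rj.
    + by apply: (keep_trans (leqnn d) _ K2); apply: keep_below E1.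
  move: P2; rewrite eo2 => P2.
  have [t2 [r2 [le2 R2 A2 K2]]] := IHc' _ _ _ _ d0 P2 sr1.
  exists (size (exp_code e d) + 1 + t2 + 2)%N, (set_reg r2 (tmp d) 1); split=> //.
  + by rewrite (size_exp_code e d); lia.
  + rewrite !size_cat /= !size_cat /=.
    apply: (@reach_trans _ _ 2 _ _ _ _).
      by apply: reach_trans R2; apply: reach_trans Rj.
    move: Pk Pl; rewrite eo2 => Pk Pl.
    apply: (@reach_trans _ 1 1); first by apply: reach_step Pk _.
    apply: reach_step Pl _.
    rewrite /= set_regE eqxx /=; congr State.
    by rewrite /o1 /o2; lia.
  + apply: agree_below d0 _ A2; exact: eq_below_set.
  + apply: (@keep_trans _ d _ r1) => //; first by apply: keep_below E1.
    apply: (keep_trans (leqnn d) K2); apply: (keep_below (leqnn d)).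
    exact: eq_below_set.
- rewrite /=; set p := code c d.+1 (o + 4).
  move=> /code_at_cons[P0 /code_at_cons[P1 /code_at_cons[P2 /code_at_cons[P3]]]].
  rewrite -[o.+4]addn4 => /code_at_cat[Pp /code_at_cons[P4 /code_at_cons[P5 /code_at1 P6]]] sr.
  pose L := (o + 4 + size p + 2)%N.
  have {}P6 : onth P L = Some (JumpPos (tmp d) (o + 4)) by rewrite /L addn2.
  (* The code enters the loop at its final test, at [L]. A pass costs the successful test, the body
     and the two instructions that decrement the counter; the last step is the failing test. The
     counter is set once, so growth of the bound inside the body does not add passes. *)
  have loop k s' r' : agree s' r' -> r' (tmp d) = k%:Z ->
      exists t r'', [/\ (t <= k * (time_bound c (bound (iter k (sem c) s')) + 3) + 1)%N,
        reach P t (State L r' (input s') (output s'))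
          (State L.+1 r'' (input (iter k (sem c) s')) (output (iter k (sem c) s'))),
        agree (iter k (sem c) s') r'' & keep d r' r''].
    elim: k s' r' => [|k IHk] s' r' sr' rk.
      exists 1%N, r'; split=> //.
      by apply: reach_step P6 _; rewrite /= rk.
    have [t1 [r1 [le1 R1 A1 K1]]] := IHc _ _ _ _ (ltn0Sn d) Pp sr'.
    pose r2 := set_reg (set_reg r1 (tmp d.+1) 1) (tmp d) k%:Z.
    have E2 : eq_below d r1 r2 by apply: eq_below_set => //; apply: eq_below_set.
    have A2 : agree (sem c s') r2 by apply: agree_below E2 A1.
    have R2 : reach P 2
        (State (o + 4 + size p) r1 (input (sem c s')) (output (sem c s')))
        (State L r2 (input (sem c s')) (output (sem c s'))).
      apply: (@reach_trans _ 1 1); first by apply: reach_step P4 _.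
      apply: reach_step P5 _; rewrite /= !set_regE !regE K1 ?d0 ?ltnSn // rk /L addn2.
      by congr (State _ (set_reg _ _ _) _ _); lia.
    have [||t3 [r3 [le3 R3 A3 K3]]] := IHk (sem c s') r2.
    + by [].
    + by rewrite /r2 set_regE eqxx.
    rewrite iterSr; exists (1 + t1 + 2 + t3)%N, r3; split=> //.
    + suff: (t1 <= time_bound c (bound (iter k (sem c) (sem c s'))))%N by lia.
      apply: leq_trans le1 (time_bound_mono c _).
      by elim: (k) => //= i IHi; apply: leq_trans IHi (bound_mono _ _).
    + apply: reach_trans R3; apply: reach_trans R2; apply: reach_trans R1.
      by apply: reach_step P6 _; rewrite /= rk.
    + apply: (keep_trans (leqnn d) _ K3).
      apply: (@keep_trans _ d _ r1); [by []| |exact: keep_below E2].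
      by move=> j /andP[j0 lt_j]; rewrite K1 // j0 ltnW.
  pose r1 := set_reg (set_reg (set_reg r (tmp d) 0) (tmp d) (bound s)%:Z) (tmp d.+1) 1.
  have E1 : eq_below d r r1 by do 3?apply: eq_below_set => //.
  have R1 : reach P 4 (State o r (input s) (output s)) (State L r1 (input s) (output s)).
    apply: (@reach_trans _ 1 3); first by apply: reach_step P0 _.
    apply: (@reach_trans _ 1 2); first by apply: reach_step P1 _.
    apply: (@reach_trans _ 1 1); first by apply: reach_step P2 _.
    apply: reach_step P3 _; rewrite /= !set_regE !regE /=; congr State.
    by rewrite ltn_eqF // add0r sr.2.
  have [||t2 [r2 [le2 R2 A2 K2]]] := loop (bound s) s r1.
  + exact: agree_below E1 sr.
  + by rewrite /r1 !set_regE !regE.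
  exists (4 + t2)%N, r2; split=> //.
  + have := leq_mul (bound_mono (Loop c) s) (leqnn (time_bound c (bound (sem (Loop c) s)) + 3)).
    by rewrite /= in le2 *; lia.
  + rewrite size_cat /=.
    have -> : (o + (size p + 3).+4 = L.+1)%N by rewrite /L; lia.
    exact: reach_trans R1 R2.
  + by apply: (keep_trans (leqnn d) _ K2); apply: keep_below E1.
- move=> Pc sr.
  exists (size (code (Input a e) d o)).
  move: Pc; rewrite [code _ _ _]/= => Pc.
  have := Pc; rewrite code_at_cat => -[Pp /code_at_cons[Pr /code_at1 Ps]].
  have simp : all simple (exp_code e d ++ addr_code a d).
    by rewrite !all_cat simple_addr !simple_exp.
  have := run_simple r (input s) (output s) Pp simp.
  have [] := exp_addr_correct e a d0 sr; set r1 := foldl _ _ _ => v1 E1 R.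
  exists (set_reg (set_reg r1 (tmp d.+1) (head 0 (input s)))
            (addr a (eval s e)) (head 0 (input s))).
  have E2 : eq_below d r (set_reg r1 (tmp d.+1) (head 0 (input s))).
    exact: eq_below_set.
  split.
  + by move: (size_code_input a e d o) => /= ->.
  + rewrite size_cat addnA /=; apply: reach_trans R _.
    apply: (@reach_trans _ 1 1); first by apply: reach_step Pr _.
    by apply: reach_step Ps _; rewrite /= !set_regE !regE v1 addn2.
  + by have [M B] := agree_put a (eval s e) (head 0 (input s)) d0 sr E2; split.
  + by apply: keep_set_addr; apply: keep_below E2.
- rewrite /= => /code_at_cat[Pe /code_at1 Pw] sr.
  have := run_simple r (input s) (output s) Pe (simple_exp e d).
  have [] := exp_code_correct e d0 sr; set r1 := foldl _ _ _ => v1 E1 R.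
  exists (size (exp_code e d) + 1)%N, r1; split.
  + by rewrite size_cat (size_exp_code e d).
  + rewrite size_cat addnA /=; apply: reach_trans R _.
    by apply: reach_step Pw _; rewrite /= v1 addn1.
  + by have [] := agree_below d0 E1 sr.
  + exact: keep_below E1.
- rewrite /= => /code_at_cat[Pe].
  move=> /code_at_cons[Pj /code_at_cons[Pk /code_at1 Pa]] sr.
  have := run_simple r (input s) (output s) Pe (simple_exp e d).
  have [] := exp_code_correct e d0 sr; set r1 := foldl _ _ _ => v1 E1 R.
  have sr1 := agree_below d0 E1 sr.
  pose r2 := if 0 < eval s e then r1 else set_reg r1 (tmp d) 0.
  have E2 : eq_below d r r2 by rewrite /r2; case: ifP => // _; apply: eq_below_set.
  have [k [lek R2]] : exists k, (k <= 2)%N /\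
      reach P k (State (o + size (exp_code e d)) r1 (input s) (output s))
        (State (o + size (exp_code e d) + 2) r2 (input s) (output s)).
    rewrite /r2; case: ifP => sg; [exists 1%N|exists 2]; split=> //.
      by apply: reach_step Pj _; rewrite /= v1 sg.
    apply: (@reach_trans _ 1 1); first by apply: reach_step Pj _; rewrite /= v1 sg.
    by apply: reach_step Pk _; rewrite /= addn2.
  exists (size (exp_code e d) + k + 1)%N,
    (set_reg r2 (tmp 0) (bound s + pos_part (eval s e))%N%:Z).
  split.
  + by rewrite size_cat (size_exp_code e d) /=; lia.
  + rewrite size_cat !addnA /=; apply: (reach_trans (reach_trans R R2)).
    rewrite addn2; apply: reach_step Pa _ => /=; congr State; first by lia.
    congr set_reg; rewrite (proj2 (agree_below d0 E2 sr)) /r2 /pos_part.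
    case: ifP => [sg|_]; rewrite ?set_regE ?eqxx ?v1; lia.
  + by apply: agree_set_bound; apply: agree_below E2 sr.
  + by apply: keep_set_bound; apply: keep_below E2.
- rewrite /=; set p := exp_code e d; set g := up_log 2 _.
  move=> /code_at_cat[Pe].
  move=> /code_at_cons[P0 /code_at_cons[P1 /code_at_cons[P2]]].
  move=> /code_at_cons[P3 /code_at_cons[P4 /code_at_cons[P5 /code_at1 P6]]] sr.
  have := run_simple r (input s) (output s) Pe (simple_exp e d).
  have [] := exp_code_correct e d0 sr; set r1 := foldl _ _ _ => v1 E1 R.
  pose L := (o + size p + 5)%N.
  have eL : L = (o + size p).+4.+1 by rewrite /L !addnS addn0.
  have {}P3 : onth P (o + size p + 3) = Some (Add (tmp d.+1) (tmp d.+1) (tmp d.+1)).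
    by rewrite addn3.
  have {}P4 : onth P (o + size p + 3).+1 = Some (Add (tmp 0) (tmp 0) (tmp d.+2)).
    by rewrite addn3.
  have {}P5 : onth P L = Some (Defs.Sub (tmp d.+3) (tmp d) (tmp d.+1)).
    by rewrite eL.
  have {}P6 : onth P L.+1 = Some (JumpPos (tmp d.+3) (o + size p + 3)).
    by rewrite eL.
  (* The code doubles 2^j, starting from 1, until it reaches the value of [e], and [k] counts the
     doublings left. That the value is reached after [g] doublings and not earlier is the definition
     of [up_log]. *)
  have loop k j b r' : (j + k = g)%N ->
      agree (Store (cell s) b (input s) (output s)) r' ->
      r' (tmp d) = eval s e -> r' (tmp d.+1) = (2 ^ j)%N%:Z -> r' (tmp d.+2) = 1 ->
      exists r'', [/\ reach P (4 * k + 2) (State L r' (input s) (output s))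
                       (State L.+2 r'' (input s) (output s)),
        agree (Store (cell s) (b + k)%N (input s) (output s)) r'' & keep d r' r''].
    elim: k j b r' => [|k IHk] j b r' jk sr' v0 vj vd.
      exists (set_reg r' (tmp d.+3) (eval s e - (2 ^ j)%N%:Z)).
      have E : eq_below d r' (set_reg r' (tmp d.+3) (eval s e - (2 ^ j)%N%:Z)).
        by apply: eq_below_set => //; lia.
      split.
      - apply: (@reach_trans _ 1 1).
          by apply: reach_step P5 _; rewrite /= v0 vj.
        apply: reach_step P6 _.
        rewrite /= set_regE eqxx ifF //; apply/negbTE; rewrite -leNgt subr_le0.
        have := @up_logP 2 (pos_part (eval s e)) isT; rewrite -/g -jk addn0.
        by rewrite /pos_part; case: ifP; lia.
      - by rewrite addn0; apply: agree_below E sr'.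
      - exact: keep_below E.
    have lt_j : (2 ^ j)%N%:Z < eval s e.
      rewrite ltNge; apply/negP=> le_e.
      suff: (g <= j)%N by lia.
      by apply: up_log_min => //; rewrite /pos_part; case: ifP; lia.
    pose r2 := set_reg (set_reg (set_reg r' (tmp d.+3) (eval s e - (2 ^ j)%N%:Z))
      (tmp d.+1) (2 ^ j.+1)%N%:Z) (tmp 0) b.+1%:Z.
    have [|||||r3 [R3 A3 K3]] := IHk j.+1 b.+1 r2.
    - by lia.
    - apply: (agree_set_bound b.+1 (s := Store _ b _ _)); apply: (agree_below d0 _ sr').
      by do 2?apply: eq_below_set => //; lia.
    - by rewrite /r2 !set_regE !regE gtn_eqF.
    - by rewrite /r2 !set_regE !regE gtn_eqF.
    - by rewrite /r2 !set_regE !regE gtn_eqF.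
    exists r3; split.
    - have -> : (4 * k.+1 + 2 = 4 + (4 * k + 2))%N by lia.
      apply: reach_trans R3.
      apply: (@reach_trans _ 1 3).
        by apply: reach_step P5 _; rewrite /= v0 vj.
      apply: (@reach_trans _ 1 2).
        apply: reach_step P6 _.
        by rewrite /= set_regE eqxx subr_gt0 lt_j.
      apply: (@reach_trans _ 1 1).
        by apply: reach_step P3 _.
      apply: reach_step P4 _.
      rewrite /= !set_regE !regE /r2 vj vd (proj2 sr') /=.
      congr State; first by rewrite /L; lia.
      by congr (set_reg (set_reg _ _ _) _ _); rewrite ?expnS; lia.
    - by move: A3; rewrite addSnnS.
    - apply: (keep_trans (leqnn d) _ K3); apply: keep_set_bound.
      by apply: (keep_below (leqnn d)); do 2?apply: eq_below_set => //; lia.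
  pose r2 := set_reg (set_reg r1 (tmp d.+1) 1) (tmp d.+2) 1.
  have E2 : eq_below d r r2 by do 2?apply: eq_below_set => //; lia.
  have [|||||r3 [R3 A3 K3]] := loop g 0%N (bound s) r2.
  + by [].
  + by have [] := agree_below d0 E2 sr.
  + by rewrite /r2 !set_regE !regE.
  + by rewrite /r2 !set_regE !regE.
  + by rewrite /r2 !set_regE !regE.
  exists (size p + (3 + (4 * g + 2)))%N, r3; split=> //.
  + by rewrite {1}/p (size_exp_code e d); lia.
  + rewrite size_cat /=.
    have -> : (o + (size p + 7) = L.+2)%N by rewrite /L; lia.
    apply: reach_trans R _; apply: reach_trans R3.
    apply: (@reach_trans _ 1 2); first by apply: reach_step P0 _.
    apply: (@reach_trans _ 1 1); first by apply: reach_step P1 _.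
    by apply: reach_step P2 _; rewrite /= set_regE eqxx.
  + by apply: (keep_trans (leqnn d) _ K3); apply: keep_below E2.
Qed.

(** * Halting and polynomial running time of compiled commands *)

Definition start (x : seq int) : store := Store (fun _ _ => 0) 0 x [::].

Lemma halts_compiled c x t :
  (time_bound c (bound (sem c (start x))) <= t)%N ->
  halts_within (code c 1 0) x t (output (sem c (start x))).
Proof.
move=> le_t; set P := code c 1 0.
have PP : code_at P 0 (code c 1 0) by [].
have [|t' [r' [le_t' R _ _]]] := code_correct (r := fun=> 0) (s := start x) (ltn0Sn 0) PP.
  by split.
rewrite /halts_within -(subnK (leq_trans le_t' le_t)) iterD R add0n.
set st := State _ _ _ _.
suff -> : iter (t - t') (step P) st = st by rewrite /st leqnn.
elim: (t - t')%N => //= k ->.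
by rewrite /step /= onthE nth_default // size_map.
Qed.

(** Functions with such a bound are closed under sums and under multiplication by N, and
    [time_bound] is built from constants by these two operations. *)
Lemma time_bound_poly c : exists A k, forall N, (time_bound c N <= A * N.+1 ^ k)%N.
Proof.
have cst n : exists A k, forall N, (n <= A * N.+1 ^ k)%N.
  by exists n, 0%N => N; rewrite muln1.
have add f g : (exists A k, forall N, (f N <= A * N.+1 ^ k)%N) ->
    (exists A k, forall N, (g N <= A * N.+1 ^ k)%N) ->
    exists A k, forall N, (f N + g N <= A * N.+1 ^ k)%N.
  move=> [A [k Hf]] [B [l Hg]]; exists (A + B)%N, (k + l)%N => N.
  rewrite mulnDl leq_add ?(leq_trans (Hf N)) ?(leq_trans (Hg N)) //.
    by rewrite leq_mul2l leq_pexp2l ?leq_addr ?orbT.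
  by rewrite leq_mul2l leq_pexp2l ?leq_addl ?orbT.
have mulN f : (exists A k, forall N, (f N <= A * N.+1 ^ k)%N) ->
    exists A k, forall N, (N * f N <= A * N.+1 ^ k)%N.
  move=> [A [k Hf]]; exists A, k.+1 => N.
  by rewrite expnS mulnCA leq_mul.
elim: c => [|a e f|c IHc d IHd|e c IHc d IHd|c IHc|a e|e|e|e];
  try exact: (cst (size (code _ 0 0))).
- exact: (cst 0%N).
- exact: (add (time_bound c) (time_bound d)).
- exact: (add (fun N => _ + time_bound c N)%N (time_bound d) (add _ _ (cst _) IHc) IHd).
- exact: (add (fun=> 5%N) (fun N => N * (time_bound c N + 3))%N (cst _)
           (mulN (fun N => time_bound c N + 3)%N (add (time_bound c) _ IHc (cst _)))).
- exact: (add _ (fun N => N * 4)%N (cst _) (mulN _ (cst _))).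
Qed.

(** The constant factor is absorbed into the exponent: with B = A (C+1)^k one has B <= 2^B <= S^B,
    since the size S is at least 2. *)
Lemma polynomial_time c C : exists P k, forall x,
  (2 <= input_size x)%N ->
  (bound (sem c (start x)) <= C * input_size x)%N ->
  halts_within P x (input_size x ^ k + k)%N (output (sem c (start x))).
Proof.
have [A [k Hk]] := time_bound_poly c.
have wexp2r m n e : (m <= n -> m ^ e <= n ^ e)%N by case: e => // e; rewrite leq_exp2r.
exists (code c 1 0), (A * C.+1 ^ k + k)%N => x; set S := input_size x => S2 leb.
apply: halts_compiled; apply: leq_trans (Hk _) _; apply: leq_trans (leq_addr _ _).
apply: (@leq_trans (A * (C.+1 * S) ^ k)%N).
  by rewrite leq_mul2l wexp2r ?orbT // mulSn; lia.
rewrite expnMn mulnA expnD leq_mul2r; apply/orP; right.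
by apply: leq_trans (ltnW (ltn_expl _ (isT : 1 < 2)%N)) _; rewrite wexp2r.
Qed.

(** * Residual networks *)

(* The vertices are the naturals below [W]; a network is a matrix [r] of
   residual capacities. *)
Section Residual.
Variables (W s : nat).
Hypothesis s1W : (s.+1 < W)%N.
Let sW : (s < W)%N := ltnW s1W.
Implicit Types (r : nat -> nat -> int) (d : nat -> int) (S : pred nat).

Definition out_residual r u := \sum_(v < W) r u v.

Definition cut_residual S r := \sum_(u < W | ~~ S u) \sum_(v < W | S v) r u v.

Definition is_cut S := ~~ S s /\ S s.+1.

(** Constant pair sums make the difference of [r] and [r'] antisymmetric, that is, a flow; the third
    clause is conservation away from source and sink. The last clause says that the flow on every
    arc leaving the source has not decreased, for [r u s] is the capacity to cancel it. *)
Definition flow_le r r' :=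
  [/\ forall u v, (u < W)%N -> (v < W)%N -> 0 <= r' u v,
      forall u v, (u < W)%N -> (v < W)%N -> r' u v + r' v u = r u v + r v u,
      forall u, (u < W)%N -> u != s -> u != s.+1 ->
        out_residual r' u = out_residual r u &
      forall u, (u < W)%N -> r u s <= r' u s].

Lemma flow_le_refl r :
  (forall u v, (u < W)%N -> (v < W)%N -> 0 <= r u v) -> flow_le r r.
Proof. by split. Qed.

Lemma flow_le_trans r1 r2 r3 : flow_le r1 r2 -> flow_le r2 r3 -> flow_le r1 r3.
Proof.
move=> [_ B1 C1 D1] [A2 B2 C2 D2]; split=> // [u v uW vW|u uW us ut|u uW].
- by rewrite B2 ?B1.
- by rewrite C2 ?C1.
- exact: le_trans (D1 _ _) (D2 _ _).
Qed.

Lemma cut_residual_out S r :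
  \sum_(u < W | ~~ S u) out_residual r u =
  \sum_(u < W | ~~ S u) \sum_(v < W | ~~ S v) r u v + cut_residual S r.
Proof.
rewrite /cut_residual -big_split /=; apply: eq_bigr => u _.
by rewrite /out_residual (bigID (fun v : 'I_W => S v)) /= addrC.
Qed.

(* Residual capacities inside the source side add up in pairs, so only the
   excess of the source side matters. *)
Lemma cut_residual_flow S r r' D :
  is_cut S -> flow_le r r' -> out_residual r' s = out_residual r s - D ->
  cut_residual S r' = cut_residual S r - D.
Proof.
move=> [Ss St] [_ B C _] Es.
pose Q f := \sum_(u < W | ~~ S u) \sum_(v < W | ~~ S v) f u v : int.
have Q2 f : Q f + Q f = Q (fun u v => f u v + f v u).
  rewrite {2}/Q exchange_big /= -big_split; apply: eq_bigr => u _.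
  by rewrite -big_split.
have QE : Q r' = Q r.
  have : Q r' + Q r' = Q r + Q r.
    rewrite !Q2; apply: eq_bigr => u _; apply: eq_bigr => v _.
    exact: B.
  lia.
have : \sum_(u < W | ~~ S u) out_residual r' u
       = \sum_(u < W | ~~ S u) out_residual r u - D.
  rewrite !(bigD1 (Ordinal sW) Ss) /= Es [RHS]addrAC; congr (_ + _).
  apply: eq_bigr => u /andP[Su us]; apply: C => //.
  by apply: contra Su => /eqP ->.
rewrite !cut_residual_out -/(Q r) -/(Q r') QE; lia.
Qed.

Lemma cut_residual_ge0 S r :
  (forall u v, (u < W)%N -> (v < W)%N -> 0 <= r u v) -> 0 <= cut_residual S r.
Proof. by move=> r0; do 2![apply: sumr_ge0 => ? _]; apply: r0. Qed.

Lemma cut_residual_le S r (B : int) :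
  0 <= B ->
  (forall u v, (u < W)%N -> (v < W)%N -> ~~ S u -> S v -> r u v <= B) ->
  cut_residual S r <= (W * W)%N%:Z * B.
Proof.
move=> B0 rB; apply: (@le_trans _ _ (\sum_(u < W) \sum_(v < W) B)); last first.
  by rewrite !sumr_const !card_ord -mulrnA -mulr_natl natz.
rewrite /cut_residual [leLHS]big_mkcond /=; apply: ler_sum => u _.
case: ifPn => Su; last by apply: sumr_ge0.
rewrite big_mkcond /=; apply: ler_sum => v _.
by case: ifP => // Sv; apply: rB.
Qed.

Definition push r x v (D : int) : nat -> nat -> int := fun a b =>
  r a b - (if (a == x) && (b == v) then D else 0)
        + (if (a == v) && (b == x) then D else 0).

Lemma out_residual_push r x v D u :
  (x < W)%N -> (v < W)%N ->
  out_residual (push r x v D) u =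
  out_residual r u - (if u == x then D else 0) + (if u == v then D else 0).
Proof.
move=> xW vW; rewrite /out_residual /push big_split sumrB /=.
have one y z : (y < W)%N ->
    \sum_(w < W) (if (u == z) && (w == y :> nat) then D else 0) = if u == z then D else 0.
  move=> yW; case: (u == z) => /=; last by rewrite big1.
  rewrite -big_mkcond (big_pred1 (Ordinal yW)) // => w.
by rewrite !one.
Qed.

(* Labels found by searching backwards from the sink along arcs of residual
   capacity at least [D]; label 0 means not reached. *)
Definition valid_labels r (D : int) d :=
  [/\ d s.+1 = 1, forall u, (u < W)%N -> 0 <= d u,
      forall u, (u < W)%N -> d u = 1 -> u = s.+1 &
      forall u, (u < W)%N -> 1 < d u ->
        exists v, [/\ (v < W)%N, d v = d u - 1 & D <= r u v]].

Definition closed_labels r (D : int) d :=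
  forall u v, (u < W)%N -> (v < W)%N -> 0 < d v -> D <= r u v -> 0 < d u.

(** Following parents from [u] meets every label from [d u] down to 1, and these distinct labels
    belong to distinct vertices. *)
Lemma labels_le r D d u : valid_labels r D d -> (u < W)%N -> d u <= W%:Z.
Proof.
move=> [dt d0 d1 dp] uW.
have down (k : nat) : k%:Z < d u -> exists2 v, (v < W)%N & d v = d u - k%:Z.
  elim: k => [|k IHk] lt_k; first by exists u; rewrite ?subr0.
  have [|v vW dv] := IHk; first by lia.
  have [|w [wW dw _]] := dp v vW; first by lia.
  by exists w => //; lia.
have [m dm] : exists m : nat, d u = m%:Z by exists `|d u|%N; have := d0 u uW; lia.
have sub : {subset [seq k.+1%:Z | k <- iota 0 m] <= [seq d v | v <- iota 0 W]}.
  move=> z /mapP[k]; rewrite mem_iota add0n => /= lt_k ->.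
  have [|v vW dv] := down (m - k.+1)%N; first by lia.
  by apply/mapP; exists v; [rewrite mem_iota|lia].
have := uniq_leq_size _ sub; rewrite !size_map !size_iota dm lez_nat; apply.
by rewrite map_inj_uniq ?iota_uniq // => a b; lia.
Qed.

(** A vertex without a positive label is nobody's parent, so labelling it cannot break an existing
    chain of parents. *)
Lemma valid_labels_set r D d u v :
  (u < W)%N -> (v < W)%N -> valid_labels r D d -> 0 < d v -> d u <= 0 -> D <= r u v ->
  valid_labels r D (fun w => if w == u then d v + 1 else d w).
Proof.
move=> uW vW [dt d0 d1 dp] dv du rD.
have vu : v != u by apply/eqP=> E; rewrite E in dv; lia.
split.
- by rewrite ifF //; apply/eqP=> E; rewrite -E dt in du.
- by move=> w wW; case: eqP => // _; [lia | apply: d0].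
- by move=> w wW; case: eqP => [_|_]; [lia | apply: d1].
move=> w wW; case: eqP => [-> _|_ dw].
  by exists v; rewrite (negbTE vu); split=> //; lia.
have [x [xW dx rx]] := dp w wW dw; exists x; split=> //.
by rewrite ifF //; apply/eqP=> E; rewrite E in dx; lia.
Qed.

Definition labelled d := #|[set u : 'I_W | 0 < d u]|.

(** Here [d0] holds the labels at the start of a sweep and [done] the pairs already examined. The
    last clause says that closed labels are left unextended, so that closure, once reached,
    persists. *)
Definition sweep_inv r (D : int) d0 (done : nat -> nat -> bool) d :=
  [/\ valid_labels r D d,
      forall u, (u < W)%N -> 0 < d0 u -> 0 < d u,
      forall u v, (u < W)%N -> (v < W)%N -> done u v -> 0 < d0 v -> D <= r u v -> 0 < d u &
      closed_labels r D d0 -> forall u, (u < W)%N -> 0 < d u -> 0 < d0 u].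

Lemma sweep_inv_set r D d0 (done done' : nat -> nat -> bool) d u v :
  (u < W)%N -> (v < W)%N ->
  (forall a b, done' a b -> done a b \/ a = u) ->
  sweep_inv r D d0 done d -> 0 < d v -> d u <= 0 -> D <= r u v ->
  sweep_inv r D d0 done' (fun w => if w == u then d v + 1 else d w).
Proof.
move=> uW vW dE [V M P C] dv du rD; split.
- exact: valid_labels_set.
- by move=> w wW dw; case: eqP => // _; [lia | apply: M].
- move=> a b aW bW /dE[ab|->] db rab; last by rewrite eqxx; lia.
  by case: eqP => _; [lia | apply: (P a b)].
- move=> cl w wW; case: eqP => [-> _|_]; last exact: C.
  by apply: (cl _ _ uW vW _ rD); apply: C.
Qed.

Lemma sweep_inv_skip r D d0 (done done' : nat -> nat -> bool) d u v :
  (u < W)%N -> (v < W)%N ->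
  (forall a b, done' a b -> done a b \/ a = u /\ b = v) ->
  sweep_inv r D d0 done d -> ~ [/\ 0 < d v, d u <= 0 & D <= r u v] ->
  sweep_inv r D d0 done' d.
Proof.
move=> uW vW dE [V M P C] no; split=> // a b aW bW /dE[ab|[-> ->]] db rab.
  exact: P ab db rab.
by rewrite ltNge; apply/negP=> du; apply: no; split=> //; apply: M.
Qed.

(** A sweep that adds no label has tested every arc against the final set of labelled vertices,
    which is therefore closed. Any other sweep raises the number of labels. *)
Lemma sweep_progress r D d0 d k :
  sweep_inv r D d0 (fun u v => (u < W)%N && (v < W)%N) d ->
  closed_labels r D d0 \/ (k <= labelled d0)%N ->
  closed_labels r D d \/ (k < labelled d)%N.
Proof.
move=> [V M P C] H.
have sub : [set u : 'I_W | 0 < d0 u] \subset [set u : 'I_W | 0 < d u].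
  by apply/subsetP=> u; rewrite !inE; apply: M.
case: (boolP ([set u : 'I_W | 0 < d u] \subset [set u : 'I_W | 0 < d0 u])).
  move=> sub'; left=> u v uW vW dv rD; apply: P rD => //; first by rewrite uW.
  by have /subsetP/(_ (Ordinal vW)) := sub'; rewrite !inE; apply.
move=> nsub; case: H => [cl|le_k].
  case/negP: nsub; apply/subsetP=> u; rewrite !inE; exact: C.
by right; apply: leq_ltn_trans le_k _; apply: proper_card; rewrite /proper sub.
Qed.

Lemma labelled_le d : (labelled d <= W)%N.
Proof. by rewrite -[leqRHS]card_ord; apply: max_card. Qed.

(* Position [x] of a walk that has carried [D] units from the source
   to [x], always moving to smaller labels. *)
Definition walk_inv (D : int) r0 d r x :=
  [/\ (x < W)%N /\ 0 < d x <= d s,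
      (forall u v, (u < W)%N -> (v < W)%N -> 0 <= r u v),
      (forall u v, (u < W)%N -> (v < W)%N -> r u v + r v u = r0 u v + r0 v u),
      (forall u, (u < W)%N -> out_residual r u =
        out_residual r0 u - (if u == s then D else 0) + (if u == x then D else 0)) &
      (forall u, (u < W)%N -> r0 u s <= r u s) /\
      (forall u v, (u < W)%N -> (v < W)%N -> d u <= d x -> d v < d u ->
        r u v = r0 u v)].

Lemma walk_start D r d :
  (forall u v, (u < W)%N -> (v < W)%N -> 0 <= r u v) -> 0 < d s ->
  walk_inv D r d r s.
Proof.
by move=> r0 ds; split=> // [|u _]; [rewrite ds lexx | rewrite subrK].
Qed.

Lemma walk_step D r0 d r x v :
  0 <= D -> walk_inv D r0 d r x -> (v < W)%N -> 0 < d v -> d v < d x -> D <= r x v ->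
  walk_inv D r0 d (push r x v D) v.
Proof.
move=> D0 [[xW /andP[dx dxs]] N B O [M K]] vW dv dvx rD.
have vx : v != x by apply/eqP=> E; rewrite E in dvx; lia.
split.
- by split=> //; lia.
- move=> a b aW bW; rewrite /push; have := N a b aW bW.
  by case: andP => [[/eqP-> /eqP->]|_]; case: ifP => _; lia.
- move=> a b aW bW; rewrite -B // /push [(b == x) && _]andbC [(b == v) && _]andbC.
  by lia.
- move=> u uW; rewrite out_residual_push // O //; lia.
split=> [u uW|a b aW bW da db].
  rewrite /push; have := M u uW.
  (* Labels along the walk drop strictly below that of the source, so the walk never returns there
     and no residual capacity into the source is consumed. *)
  have -> : (s == v) = false by apply/eqP=> E; rewrite E in dxs; lia.
  by rewrite andbF; case: ifP => _; lia.
rewrite /push K //; last by lia.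
have -> : (a == x) = false by apply/eqP=> E; rewrite E in da; lia.
rewrite /= subr0; case: andP => [[/eqP av /eqP bx]|]; last by rewrite addr0.
by rewrite av bx in db; lia.
Qed.

Lemma walk_end D r0 d r :
  walk_inv D r0 d r s.+1 ->
  flow_le r0 r /\ forall S, is_cut S -> cut_residual S r = cut_residual S r0 - D.
Proof.
move=> [_ N B O [M _]].
have le_r : flow_le r0 r.
  split=> // u uW us ut; rewrite O // (negbTE us) (negbTE ut) subr0 addr0 //.
split=> // S Sc; apply: cut_residual_flow => //.
by rewrite O // eqxx ifF ?addr0 //; apply/eqP; lia.
Qed.

(* When the source is not reached, the reached vertices form a cut all of whose
   arcs have residual capacity below [D]. *)
Lemma closed_cut r D d :
  valid_labels r D d -> closed_labels r D d -> d s <= 0 -> 1 <= D ->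
  exists2 S, is_cut S & cut_residual S r <= (W * W)%N%:Z * (D - 1).
Proof.
move=> [dt _ _ _] cl ds D1; exists (fun u => 0 < d u).
  by split; rewrite ?dt // -leNgt.
apply: cut_residual_le => [|u v uW vW Su Sv]; first by lia.
suff: ~~ (D <= r u v) by lia.
by apply: contra Su; apply: cl.
Qed.

End Residual.

(** * Reasoning about structured programs *)

(* The names 0, 1, 2 stand for the loop bound, the input and the output, and
   are never used as names of arrays. *)
Fixpoint mods (c : cmd) : seq nat :=
  match c with
  | Skip => [::]
  | Put a _ _ => [:: a]
  | Seq c d => mods c ++ mods d
  | If _ c d => mods c ++ mods d
  | Loop c => mods c
  | Input a _ => [:: 1%N; a]
  | Output _ => [:: 2%N]
  | AddBound _ => [:: 0%N]
  | Grow _ => [:: 0%N]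
  end.

Definition same (l : seq nat) (s t : store) : Prop :=
  [/\ forall a, a \notin l -> cell t a = cell s a,
      0%N \notin l -> bound t = bound s,
      1%N \notin l -> input t = input s &
      2%N \notin l -> output t = output s].

Lemma same_trans l s t u : same l s t -> same l t u -> same l s u.
Proof.
move=> [A B C D] [A' B' C' D']; split.
- by move=> a al; rewrite A' ?A.
- by move=> l0; rewrite B' ?B.
- by move=> l1; rewrite C' ?C.
by move=> l2; rewrite D' ?D.
Qed.

Lemma same_sub l l' s t : {subset l <= l'} -> same l s t -> same l' s t.
Proof.
move=> sub [A B C D].
by split=> [a al|l0|l1|l2]; [apply: A | apply: B | apply: C | apply: D];
  apply: contra (@sub _) _.
Qed.

Lemma upd_other m a i z b : b != a -> upd m a i z b = m b.
Proof. by rewrite /upd => /negbTE ->. Qed.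

Lemma sem_same c s : same (mods c) s (sem c s).
Proof.
have sub1 (l1 l2 : seq nat) : {subset l1 <= l1 ++ l2} by move=> a al; rewrite mem_cat al.
have sub2 (l1 l2 : seq nat) : {subset l2 <= l1 ++ l2} by move=> a al; rewrite mem_cat al orbT.
elim: c s => [|a e f|c IHc d IHd|e c IHc d IHd|c IHc|a e|e|e|e] s //=.
- by split=> // b; rewrite inE => ba; rewrite /put /= upd_other.
- exact: same_trans (same_sub (sub1 _ _) (IHc _)) (same_sub (sub2 _ _) (IHd _)).
- by case: ifP => _; [apply: same_sub (IHc _) | apply: same_sub (IHd _)].
- by elim: (bound s) => //= k IHk; apply: same_trans IHk (IHc _).
- by split=> // b; rewrite !inE negb_or => /andP[_ ba] /=; rewrite upd_other.
Qed.

(** The guard idles through the surplus passes of [Loop]; [e] passes are made only if the loop bound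
    is at least [e], which [for_rule] demands. *)
Definition For (i : nat) (e : exp) (c : cmd) : cmd :=
  Seq (Put i (Cst 0) (Cst 0))
    (Loop (If (Minus e (Get i (Cst 0)))
             (Seq c (Put i (Cst 0) (Plus (Get i (Cst 0)) (Cst 1))))
             Skip)).

(** After k passes of the underlying loop the counter is min(k, m). The [same] premises supply the
    frame: whatever the body does not assign still has its value from [s] and need not be put into
    [Inv]. *)
Lemma for_rule (m : nat) (Inv : nat -> store -> Prop) i e c s :
  i \notin mods c -> (m <= bound s)%N ->
  (forall t, same (i :: mods c) s t -> eval t e = m%:Z) ->
  Inv 0%N (put i 0 0 s) ->
  (forall k t, (k < m)%N -> same (i :: mods c) s t -> cell t i 0 = k%:Z ->
    Inv k t -> Inv k.+1 (put i 0 k.+1%:Z (sem c t))) ->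
  Inv m (sem (For i e c) s).
Proof.
move=> ic mb eE I0 IS.
pose body := Seq c (Put i (Cst 0) (Plus (Get i (Cst 0)) (Cst 1))).
rewrite -[sem _ s]/(iter (bound s) (sem (If (Minus e (Get i (Cst 0))) body Skip))
                      (put i 0 0 s)).
set s0 := put i 0 0 s.
have sub : {subset mods (If (Minus e (Get i (Cst 0))) body Skip) <= i :: mods c}.
  by move=> a; rewrite /= cats0 mem_cat !inE orbC.
have S0 : same (i :: mods c) s s0.
  by apply: same_sub (sem_same (Put i (Cst 0) (Cst 0)) s) => a; rewrite !inE => ->.
have H k : let t := iter k (sem (If (Minus e (Get i (Cst 0))) body Skip)) s0 in
    [/\ same (i :: mods c) s t, cell t i 0 = (minn k m)%:Z & Inv (minn k m) t].
  elim: k => [|k [Sk ik Ik]].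
    by rewrite min0n; split=> //; rewrite /= /upd !eqxx.
  rewrite iterS; set t := iter k _ _ in Sk ik Ik *.
  have S1 := same_trans Sk (same_sub sub (sem_same _ t)).
  split=> //; move: (S1) => _; rewrite [sem (If _ _ _) t]/= eE // ik subr_gt0 ltz_nat.
    case: ltnP => [lt_k|le_m]; last by rewrite ik; congr Posz; lia.
    have [ci _ _ _] := sem_same c t.
    rewrite /= /upd !eqxx ci // ik; lia.
  case: ltnP => [lt_k|le_m]; last first.
    by have -> : minn k.+1 m = minn k m by lia.
  have -> : minn k.+1 m = (minn k m).+1 by lia.
  have [ci _ _ _] := sem_same c t.
  rewrite /= ci // ik; have -> : (minn k m)%:Z + 1 = (minn k m).+1%:Z by lia.
  exact: IS.
have [_ _] := H (bound s).
by have -> : minn (bound s) m = m by lia.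
Qed.

Arguments For : simpl never.

Lemma sem_seq c d s : sem (Seq c d) s = sem d (sem c s).
Proof. by []. Qed.

(** * The pricing program *)

(* Scalars start with v, arrays with a.  The vertices of the flow network are
   numbered A first, then B; [vN] = nA + nB is the source, [vN] + 1 the sink and
   [vW] = [vN] + 2 the number of vertices.  The residual capacity of the arc
   (u, v) is [aR![aRow![u] + v]], where [aRow![u]] = u [vW]. *)
Local Notation vA := 3%N.
Local Notation vB := 4%N.
Local Notation vN := 5%N.
Local Notation vW := 6%N.
Local Notation aRow := 7%N.
Local Notation vI := 8%N.
Local Notation vJ := 9%N.
Local Notation vF := 10%N.
Local Notation aIsp := 11%N.
Local Notation aNum := 12%N.
Local Notation aDen := 13%N.
Local Notation aPw := 14%N.
Local Notation aCap := 15%N.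
Local Notation vX := 16%N.
Local Notation vY := 17%N.
Local Notation vAcc := 18%N.
Local Notation vK := 19%N.
Local Notation vSave := 20%N.
Local Notation vM := 21%N.
Local Notation aR := 22%N.
Local Notation vPh := 23%N.
Local Notation vT1 := 24%N.
Local Notation vT2 := 25%N.
Local Notation aD := 26%N.
Local Notation vU := 27%N.
Local Notation vV := 28%N.
Local Notation vDel := 29%N.

Local Notation "c ;; d" := (Seq c d) (at level 60, right associativity).
Local Notation "a ::= e" := (Put a (Cst 0) e) (at level 55).
Local Notation "` a" := (Get a (Cst 0)) (at level 1, a at level 0).
Local Notation "a ![ i ]" := (Get a i) (at level 2, i at level 200, left associativity).
Local Notation "e :+ f" := (Plus e f) (at level 50, left associativity).
Local Notation "e :- f" := (Minus e f) (at level 50, left associativity).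
Local Notation one := (Cst 1).
Local Notation WHEN e c := (If e c Skip).

(* Binary multiplication: the machine only adds and subtracts, so the digits of
   [vY] are found by comparison with the powers of two stored in [aPw]. *)
Definition multiply : cmd :=
  vAcc ::= Cst 0 ;;
  For vK Bound
    (vAcc ::= `vAcc :+ `vAcc ;;
     WHEN (`vY :- aPw![Bound :- one :- `vK] :+ one)
       (vY ::= `vY :- aPw![Bound :- one :- `vK] ;;
        vAcc ::= `vAcc :+ `vX)).

(** Index [vN] acts as an extra vertex with numerator 1, whose entry becomes the product of all
    denominators. Saving and restoring the entry of [vU] omits that vertex's own denominator without
    comparing indices. *)
Definition common_denominator : cmd :=
  For vV (`vN :+ one) (Put aCap (`vV) (aNum![`vV])) ;;
  For vU `vN
    (vSave ::= aCap![`vU] ;;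
     For vV (`vN :+ one)
       (vX ::= aCap![`vV] ;; vY ::= aDen![`vU] ;; multiply ;; Put aCap (`vV) (`vAcc)) ;;
     Put aCap (`vU) (`vSave)).

Definition big_capacity : cmd :=
  vM ::= one ;;
  For vJ `vB (vM ::= `vM :+ aCap![`vA :+ `vJ]).

(** Priceable vertices were given numerator 0, hence capacity 0, so this is already the network in
    which they receive no supply. Reverse arcs keep the default value 0 of a cell. *)
Definition build_network : cmd :=
  For vI `vA
    (For vJ `vB
       (Input vF (Cst 0) ;; WHEN `vF (Put aR (aRow![`vI] :+ (`vA :+ `vJ)) (`vM)))) ;;
  For vI `vA (Put aR (aRow![`vN] :+ `vI) (aCap![`vI])) ;;
  For vJ `vB (Put aR (aRow![`vA :+ `vJ] :+ (`vN :+ one)) (aCap![`vA :+ `vJ])).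

Definition search : cmd :=
  For vU `vW (Put aD (`vU) (Cst 0)) ;;
  Put aD (`vN :+ one) (one) ;;
  For vK `vW
    (For vU `vW
       (For vV `vW
          (WHEN aD![`vV] (WHEN (one :- aD![`vU])
             (WHEN (aR![aRow![`vU] :+ `vV] :- `vDel :+ one)
                (Put aD (`vU) (aD![`vV] :+ one))))))).

(** No parents are stored: any arc to a smaller positive label with enough residual capacity will
    do. If the source is unlabelled, no label is eligible and the walk changes no capacity. *)
Definition walk : cmd :=
  vX ::= `vN ;;
  For vK `vW
    (For vV `vW
       (WHEN aD![`vV] (WHEN (aD![`vX] :- aD![`vV])
          (WHEN (aR![aRow![`vX] :+ `vV] :- `vDel :+ one)
             (Put aR (aRow![`vX] :+ `vV) (aR![aRow![`vX] :+ `vV] :- `vDel) ;;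
              Put aR (aRow![`vV] :+ `vX) (aR![aRow![`vV] :+ `vX] :+ `vDel) ;;
              vX ::= `vV))))).

(** The scale runs from 2^(N-1) down to 1, N being the loop bound. Two nested loops make N^2
    attempts at augmentation per scale. *)
Definition max_flow : cmd :=
  For vPh Bound
    (vDel ::= aPw![Bound :- one :- `vPh] ;;
     For vT1 Bound (For vT2 Bound (search ;; walk))).

Definition read_vertices : cmd :=
  For vI `vN
    (Input aIsp `vI ;;
     If aIsp![`vI]
       (Put aNum (`vI) (Cst 0) ;; Put aDen (`vI) (one))
       (Input aNum `vI ;; Input aDen `vI ;;
        Grow aNum![`vI] ;; Grow aDen![`vI])).

(** Adding [vW] twice makes the square of the loop bound at least twice the square of [vW], as the
    scaling argument requires. The powers of two are tabulated after [read_vertices], when the bound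
    has its final value. *)
Definition setup : cmd :=
  Input vA (Cst 0) ;; Input vB (Cst 0) ;;
  vN ::= `vA :+ `vB ;; vW ::= `vN :+ Cst 2 ;;
  AddBound `vW ;; AddBound `vW ;;
  For vI `vW (Put aRow (`vI :+ one) (aRow![`vI] :+ `vW)) ;;
  read_vertices ;;
  Put aNum (`vN) (one) ;;
  Put aPw (Cst 0) (one) ;;
  For vK Bound (Put aPw (`vK :+ one) (aPw![`vK] :+ aPw![`vK])).

Definition enable_priceable : cmd :=
  For vI `vA (WHEN aIsp![`vI] (Put aR (aRow![`vN] :+ `vI) (`vM))).

Definition write_prices : cmd :=
  For vI `vA
    (WHEN aIsp![`vI] (Output aR![aRow![`vI] :+ `vN] ;; Output aCap![`vN])).

Definition pricing : cmd :=
  setup ;; common_denominator ;; big_capacity ;; build_network ;;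
  max_flow ;; enable_priceable ;; max_flow ;; write_prices.

(** * Correctness of multiplication and of clearing denominators *)

Definition powers (s : store) := forall k, (k <= bound s)%N -> cell s aPw k%:Z = 2 ^+ k.

Lemma multiply_correct s x y :
  powers s -> cell s vX 0 = x -> cell s vY 0 = y -> 0 <= y < 2 ^+ bound s ->
  cell (sem multiply s) vAcc 0 = x * y.
Proof.
move=> Ps Xs Ys y_bd; rewrite /multiply sem_seq.
(* Horner's scheme from the top digit: the accumulator, shifted by the digits still to come, plus
   [x] times the unread remainder of [y] is always [x * y]. *)
set s0 := sem (Put _ _ _) s; set t := sem (For _ _ _) _.
pose Inv k t := cell t vAcc 0 * 2 ^+ (bound s - k) + x * cell t vY 0 = x * y /\
                0 <= cell t vY 0 < 2 ^+ (bound s - k).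
have [] : Inv (bound s) t.
  apply: for_rule => //.
  - by move=> u [_ B _ _]; rewrite /= B.
  - by rewrite /Inv /= /upd /= Ys subn0 mul0r add0r.
  move=> k u lt_k [C B _ _] Ku [E Y]; rewrite /Inv /= /upd /= B // Ku.
  have -> : ((bound s0)%:Z - 1 - k%:Z) = (bound s - k.+1)%N%:Z by rewrite /=; lia.
  rewrite (C aPw isT) /s0 /= /upd /= Ps; last by lia.
  move: E Y; have -> : (bound s - k = (bound s - k.+1).+1)%N by lia.
  rewrite exprS; set p := 2 ^+ _ => E Y.
  have Xu : cell u vX 0 = x by rewrite (C vX isT).
  case: ifP => g /=; rewrite /upd /= ?Xu; lia.
rewrite subnn expr0 => E Y.
have Y0 : cell t vY 0 = 0 by lia.
by rewrite Y0 in E; lia.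
Qed.

Definition prod_others (den : nat -> int) (n v : nat) : int :=
  \prod_(u < n) (if u == v :> nat then 1 else den u).

Lemma common_denominator_correct s n :
  powers s -> cell s vN 0 = n%:Z -> (n < bound s)%N ->
  (forall u, (u < n)%N -> 0 <= cell s aDen u%:Z < 2 ^+ bound s) ->
  forall v, (v <= n)%N -> cell (sem common_denominator s) aCap v%:Z
    = cell s aNum v%:Z * prod_others (fun u => cell s aDen u%:Z) n v.
Proof.
move=> Ps Ns nb den_bd; rewrite /common_denominator sem_seq.
set s1 := sem (For vV _ _) s.
have S1 : same [:: aCap; vV] s s1.
  by apply: same_sub (sem_same _ s) => a; rewrite !inE => /or3P[]->; rewrite ?orbT.
have Cap1 : forall v, (v < n.+1)%N -> cell s1 aCap v%:Z = cell s aNum v%:Z.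
  rewrite /s1; apply: (for_rule (Inv := fun k t =>
    forall v, (v < k)%N -> cell t aCap v%:Z = cell s aNum v%:Z)) => //.
    by move=> t [C _ _ _]; rewrite /= (C vN isT) Ns; lia.
  move=> k t lt_k [C _ _ _] Kt H v; rewrite ltnS => le_v.
  rewrite /= /upd /= Kt eqz_nat (C aNum isT).
  by case: eqP => [->|ne] //; apply: H; lia.
have [C1 B1 _ _] := S1.
set body := (vSave ::= _ ;; _); set s2 := sem _ s1.
suff H : forall v, (v < n.+1)%N -> cell s2 aCap v%:Z
    = cell s aNum v%:Z * prod_others (fun u => cell s aDen u%:Z) n v by apply: H.
apply: (for_rule (Inv := fun k t => forall v, (v < n.+1)%N -> cell t aCap v%:Z
    = cell s aNum v%:Z * prod_others (fun u => cell s aDen u%:Z) k v)) => //.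
- by rewrite B1 // ltnW.
- by move=> t [C _ _ _]; rewrite /= (C vN isT) (C1 vN isT).
- by move=> v lt_v; rewrite /prod_others big_ord0 mulr1 -Cap1.
move=> k t lt_k St Kt H v lt_v.
rewrite /body 2!sem_seq; set t1 := sem (Put vSave _ _) t; set t2 := sem (For _ _ _) t1.
have S12 : same (mods (For vV (`vN :+ one)
   (vX ::= aCap![`vV] ;; vY ::= aDen![`vU] ;; multiply ;; Put aCap (`vV) (`vAcc)))) t1 t2.
  exact: sem_same.
have [Ct Bt _ _] := St.
have Et a : a \notin [:: vSave; vX; vY; vAcc; vK; vV; aCap; vU] -> cell t1 a = cell s a.
  rewrite !inE !negb_or => /and5P[n1 n2 n3 n4 /and4P[n5 n6 n7 n8]].
  rewrite /t1 /= upd_other // Ct ?C1 // !inE !negb_or ?n1 ?n2 ?n3 ?n4 ?n5 ?n6 ?n7 ?n8 //.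
have H2 : forall v, (v < n.+1)%N -> cell t2 aCap v%:Z =
    cell t aCap v%:Z * (if (v < n.+1)%N then cell s aDen k%:Z else 1).
  apply: (for_rule (Inv := fun j w => forall v, (v < n.+1)%N -> cell w aCap v%:Z =
    cell t aCap v%:Z * (if (v < j)%N then cell s aDen k%:Z else 1))) => //.
  - by rewrite /= Bt // B1.
  - by move=> w [C _ _ _]; rewrite /= (C vN isT) (Et vN isT) Ns; lia.
  - by move=> w lt_w; rewrite ltn0 mulr1.
  move=> j w lt_j Sw Jw Hw x lt_x; rewrite 3!sem_seq.
  set w1 := sem (Put vY _ _) _.
  have [Cw Bw _ _] := Sw.
  have Bw1 : bound w1 = bound s by rewrite /= Bw //= Bt // B1.
  have Pw1 : cell w1 aPw = cell s aPw.
    by rewrite /= /upd /= (Cw aPw isT) (Et aPw isT).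
  have Dw : cell w aDen (cell w vU 0) = cell s aDen k%:Z.
    by rewrite (Cw aDen isT) (Cw vU isT) (Et aDen isT) /t1 /= /upd /= Kt.
  have acc : cell (sem multiply w1) vAcc 0 = cell w aCap j%:Z * cell s aDen k%:Z.
    apply: multiply_correct.
    - by move=> i; rewrite Pw1 Bw1; apply: Ps.
    - by rewrite /= /upd /= Jw.
    - by rewrite /= /upd /= Dw.
    - by rewrite Bw1 den_bd.
  have [Cm _ _ _] := sem_same multiply w1.
  rewrite /= /upd /= -/w1 acc (Cm aCap isT) (Cm vV isT) /= /upd /= Jw eqz_nat.
  case: eqP => [->|ne]; first by rewrite ltnSn Hw // ltnn mulr1.
  by rewrite Hw // ltnS [(x <= j)%N]leq_eqVlt; case: (x =P j) ne.
have [C2 _ _ _] := S12.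
rewrite /= /upd /= (C2 vSave isT) (C2 vU isT) /= /upd /= Kt eqz_nat /prod_others big_ord_recr /=.
case: (v =P k) => [->|ne].
  by rewrite eqxx mulr1 H //; lia.
rewrite eq_sym ifF; last by apply/eqP.
by rewrite H2 // lt_v H // mulrA.
Qed.

Lemma sem_if e c d s : sem (If e c d) s = if 0 < eval s e then sem c s else sem d s.
Proof. by [].  Qed.

(** * Correctness of search, augmentation and scaling *)

Definition mat (s : store) (W u v : nat) : int := cell s aR (u * W + v)%N%:Z.
Definition label (s : store) (u : nat) : int := cell s aD u%:Z.

Lemma mat_index W u v u' v' : (v < W)%N -> (v' < W)%N ->
  ((u * W + v)%N == (u' * W + v')%N) = (u == u') && (v == v').
Proof.
move=> vW vW'; apply/eqP/andP => [E|[/eqP-> /eqP->]//].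
have W0 : (0 < W)%N by apply: leq_ltn_trans vW.
have := congr1 (divn^~ W) E; have := congr1 (modn^~ W) E.
by rewrite !modnMDl !modn_small // !divnMDl // !divn_small // !addn0 => -> ->.
Qed.

Lemma upd_label m u z v :
  upd m aD u%:Z z aD v%:Z = if v == u then z else m aD v%:Z.
Proof. by rewrite /upd eqxx eqz_nat. Qed.

Record flow_env (n : nat) (D : int) (s : store) : Prop := FlowEnv {
  env_n : cell s vN 0 = n%:Z;
  env_W : cell s vW 0 = n.+2%:Z;
  env_row : forall u, (u < n.+2)%N -> cell s aRow u%:Z = (u * n.+2)%N%:Z;
  env_bound : (n.+2 <= bound s)%N;
  env_D : cell s vDel 0 = D
}.

Lemma flow_env_same n D l s t :
  same l s t -> all (fun a => a \notin l) [:: vN; vW; aRow; 0%N; vDel] ->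
  flow_env n D s -> flow_env n D t.
Proof.
move=> [C B _ _] /and5P[l1 l2 l3 l4 /andP[l5 _]] [e1 e2 e3 e4 e5].
by split; rewrite ?(C _ l1) ?(C _ l2) ?(C _ l3) ?B ?(C _ l5).
Qed.

Lemma search_correct n D s : flow_env n D s ->
  let t := sem search s in
  valid_labels n.+2 n (mat s n.+2) D (label t) /\
  closed_labels n.+2 (mat s n.+2) D (label t).
Proof.
move=> env t0; rewrite {}/t0 /search 2!sem_seq.
set W := n.+2; have nW : (n.+1 < W)%N by [].
set s1 := sem (For vU _ _) s.
have S1 : same [:: aD; vU] s s1.
  by apply: same_sub (sem_same _ s) => a; rewrite !inE => /or3P[]->; rewrite ?orbT.
have L1 : forall u, (u < W)%N -> label s1 u = 0.
  apply: (for_rule (Inv := fun k t => forall u, (u < k)%N -> label t u = 0)) => //.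
  - exact: env_bound env.
  - by move=> t [C _ _ _]; rewrite /= (C vW isT) (env_W env).
  move=> k t lt_k _ Kt H u; rewrite ltnS => le_u.
  rewrite /label /= upd_other //= Kt upd_label.
  by case: eqP => // ne; apply: H; lia.
have E1 := flow_env_same S1 isT env.
set s2 := sem (Put aD _ _) s1.
have S2 : same [:: aD; vU] s s2.
  apply: same_trans S1 _; apply: same_sub (sem_same _ s1) => a.
  by rewrite !inE => ->.
have E2 := flow_env_same S2 isT env.
have L2 u : (u < W)%N -> label s2 u = if u == n.+1 then 1 else 0.
  move=> uW; rewrite /label /= (env_n E1) (_ : n%:Z + 1 = n.+1%:Z); last by lia.
  by rewrite upd_label -/(label s1 u) L1.
set r := mat s W.
(* The inequality is strict because the sink is labelled before the first sweep; after W sweeps the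
   second alternative would mean more than W labelled vertices. *)
pose Inv k t := valid_labels W n r D (label t) /\
  (closed_labels W r D (label t) \/ (k < labelled W (label t))%N).
set t := sem _ s2.
suff [V [cl|lt_W]] : Inv W t.
- by split.
- by have := labelled_le W (label t); rewrite leqNgt lt_W.
apply: for_rule => //.
- exact: env_bound E2.
- by move=> u [C _ _ _]; rewrite /= (C vW isT) (env_W E2).
- have L3 u : (u < W)%N -> label (put vK 0 0 s2) u = if u == n.+1 then 1 else 0.
    exact: L2.
  split.
    split=> [|u uW|u uW|u uW]; rewrite L3 ?eqxx //; first by case: ifP.
      by case: eqP.
    by case: ifP.
  right; apply/card_gt0P; exists (Ordinal nW).
  by rewrite inE L3 // eqxx.
move=> {t} k t lt_k St Kt [V P]; rewrite /Inv -/(label _).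
set t' := sem _ t.
suff H : sweep_inv W n r D (label t) (fun u v => (u < W)%N && (v < W)%N) (label t').
  by split; [case: H | apply: sweep_progress H P].
have Et : flow_env n D t by apply: flow_env_same St _ E2.
have Rt : cell t aR = cell s aR.
  by have [C _ _ _] := St; have [C2 _ _ _] := S2; rewrite (C aR isT) (C2 aR isT).
apply: (for_rule (Inv := fun i w =>
  sweep_inv W n r D (label t) (fun u v => (u < i)%N && (v < W)%N) (label w))) => //.
- exact: env_bound Et.
- by move=> w [C _ _ _]; rewrite /= (C vW isT) (env_W Et).
move=> i w lt_i Sw Iw H.
have Ew : flow_env n D w by apply: flow_env_same Sw _ Et.
have Rw : cell w aR = cell s aR by have [C _ _ _] := Sw; rewrite (C aR isT).
pose done j u v := (u < i)%N && (v < W)%N || (u == i)%N && (v < j)%N.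
suff : sweep_inv W n r D (label t) (done W) (label (sem (For vV (`vW)
          (WHEN aD![`vV] (WHEN (one :- aD![`vU])
             (WHEN (aR![aRow![`vU] :+ `vV] :- `vDel :+ one)
                (Put aD (`vU) (aD![`vV] :+ one)))))) w)).
  move=> [A1 A2 A3 A4]; split=> // u v uW vW /andP[ui _]; apply: A3 => //.
  by rewrite /done vW !andbT; move: ui; rewrite ltnS leq_eqVlt orbC.
apply: (for_rule (Inv := fun j x => sweep_inv W n r D (label t) (done j) (label x))) => //.
- exact: env_bound Ew.
- by move=> x [C _ _ _]; rewrite /= (C vW isT) (env_W Ew).
- case: H => A1 A2 A3 A4; split=> // u v uW vW; rewrite /done ltn0 andbF orbF.
  exact: A3.
move=> j x lt_j Sx Jx H'.
have Ex : flow_env n D x by apply: flow_env_same Sx _ Ew.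
have [C _ _ _] := Sx.
have Rx : cell x aR = cell s aR by rewrite (C aR isT).
have Ix : cell x vU 0 = i%:Z by rewrite (C vU isT).
have doneS u v : done j.+1 u v -> done j u v \/ u = i /\ v = j.
  rewrite /done; case/orP => [->|/andP[/eqP-> lt_v]]; [by left|].
  by case: (v =P j) => [|ne]; [right | left; rewrite eqxx /=; lia].
rewrite [sem _ x]/= Jx Ix (env_row Ex) // (env_D Ex) Rx.
rewrite -PoszD -[cell s aR _]/(r i j) -/(label x j) -/(label x i).
case: ifP => [dj|ndj]; last first.
  by apply: (sweep_inv_skip _ _ doneS H') => // -[]; rewrite ndj.
case: ifP => [di|ndi]; last first.
  by apply: (sweep_inv_skip _ _ doneS H') => // -[_ ? _]; lia.
case: ifP => [rij|nrij]; last first.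
  by apply: (sweep_inv_skip _ _ doneS H') => // -[_ _ ?]; lia.
have -> : label (put vV 0 j.+1%:Z (put aD i%:Z (label x j + 1) x)) =
    fun u => if u == i then label x j + 1 else label x u.
  by apply: boolp.funext => u; rewrite /label /= upd_other // upd_label.
apply: (sweep_inv_set nW _ _ _ H') => //; try lia.
by move=> u v /doneS[|[]]; [left|right].
Qed.

Lemma mat_put s W u v z : (v < W)%N ->
  forall u' v', (v' < W)%N ->
  mat (put aR (u * W + v)%N%:Z z s) W u' v'
  = if (u' == u) && (v' == v) then z else mat s W u' v'.
Proof.
by move=> vW u' v' vW'; rewrite /mat /= /upd eqxx eqz_nat mat_index.
Qed.

Definition nonneg (W : nat) (r : nat -> nat -> int) :=
  forall u v, (u < W)%N -> (v < W)%N -> 0 <= r u v.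

Lemma eq_walk_inv W s D r0 d r r' x :
  (forall u v, (u < W)%N -> (v < W)%N -> r' u v = r u v) -> (s < W)%N ->
  walk_inv W s D r0 d r x -> walk_inv W s D r0 d r' x.
Proof.
move=> E sW [X N B O [M K]]; split=> // [u v uW vW|u v uW vW|u uW|].
- by rewrite E // N.
- by rewrite !E // B.
- by rewrite -O //; apply: eq_bigr => v _; apply: E.
by split=> [u uW|u v uW vW du dv]; rewrite E //; [apply: M | apply: K].
Qed.

Definition walk_step_cmd : cmd :=
  WHEN aD![`vV] (WHEN (aD![`vX] :- aD![`vV])
    (WHEN (aR![aRow![`vX] :+ `vV] :- `vDel :+ one)
       (Put aR (aRow![`vX] :+ `vV) (aR![aRow![`vX] :+ `vV] :- `vDel) ;;
        Put aR (aRow![`vV] :+ `vX) (aR![aRow![`vV] :+ `vX] :+ `vDel) ;;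
        vX ::= `vV))).

Lemma walk_step_correct n D s (x v : nat) :
  flow_env n D s -> cell s vX 0 = x%:Z -> cell s vV 0 = v%:Z ->
  (x < n.+2)%N -> (v < n.+2)%N ->
  if [&& 0 < label s v, label s v < label s x & D <= mat s n.+2 x v] then
    cell (sem walk_step_cmd s) vX 0 = v%:Z /\
    forall a b, (a < n.+2)%N -> (b < n.+2)%N ->
      mat (sem walk_step_cmd s) n.+2 a b = push (mat s n.+2) x v D a b
  else sem walk_step_cmd s = s.
Proof.
set W := n.+2 => env Xs Vs xW vW.
have ix t : cell t aRow = cell s aRow -> cell t vX 0 = x%:Z -> cell t vV 0 = v%:Z ->
    (eval t (aRow![`vX] :+ `vV) = (x * W + v)%N%:Z) *
    (eval t (aRow![`vV] :+ `vX) = (v * W + x)%N%:Z).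
  by move=> Rt Xt Vt; rewrite /= Rt Xt Vt !(env_row env).
have e1 : eval s (aD![`vX] :- aD![`vV]) = label s x - label s v by rewrite /= Xs Vs.
have ef f : eval s (aR![aRow![`vX] :+ `vV] :- `vDel :+ f) = mat s W x v - D + eval s f.
  by rewrite -(env_D env) /mat -(ix s erefl Xs Vs).1.
have -> : sem walk_step_cmd s = if [&& 0 < label s v, label s v < label s x & D <= mat s W x v]
  then put vX 0 v%:Z
    (put aR (v * W + x)%N%:Z
       (mat (put aR (x * W + v)%N%:Z (mat s W x v - D) s) W v x + D)
       (put aR (x * W + v)%N%:Z (mat s W x v - D) s)) else s.
  rewrite /walk_step_cmd !sem_if e1 ef [eval s _]/= Vs -/(label s v) subr_gt0 ltzD1 subr_ge0.
  case: (boolP [&& _, _ & _]) => [/and3P[-> -> ->]|]; last first.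
    by case: (0 < _) => //; case: (label s v < _) => //; case: (D <= _).
  rewrite 2!sem_seq.
  have -> : sem (Put aR (aRow![`vX] :+ `vV) (aR![aRow![`vX] :+ `vV] :- `vDel)) s
          = put aR (x * W + v)%N%:Z (mat s W x v - D) s.
    rewrite -(env_D env) /mat -(ix s erefl Xs Vs).1; reflexivity.
  set s1 := put _ _ _ s.
  have Ds1 : cell s1 vDel 0 = D by exact: env_D env.
  have -> : sem (Put aR (aRow![`vV] :+ `vX) (aR![aRow![`vV] :+ `vX] :+ `vDel)) s1
          = put aR (v * W + x)%N%:Z (mat s1 W v x + D) s1.
    rewrite -Ds1 /mat -(ix s1 erefl Xs Vs).2; reflexivity.
  by rewrite -Vs.
case: (boolP [&& _, _ & _]) => [/and3P[dv dvx rD]|//]; split=> // a b aW bW.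
rewrite -[mat (put vX _ _ _) W a b]/(mat (put aR (v * W + x)%N%:Z _ _) W a b).
(* As [x] and [v] differ, the two assignments concern different entries, and the second reads a
   value that the first has left alone. *)
have xv : x != v by apply/eqP=> E; rewrite E ltxx in dvx.
rewrite mat_put // !mat_put // /push.
case: (a =P v) => [->|nav] /=.
  rewrite [v == x]eq_sym (negbTE xv) /= subr0.
  by case: (b =P x) => [->|_]; rewrite ?addr0.
rewrite addr0; case: ifP => [/andP[/eqP-> /eqP->]//|_]; by rewrite subr0.
Qed.

Lemma walk_correct n D s : flow_env n D s -> 0 <= D ->
  let r := mat s n.+2 in let r' := mat (sem walk s) n.+2 in
  nonneg n.+2 r -> valid_labels n.+2 n r D (label s) ->
  if 0 < label s n then
    flow_le n.+2 n r r' /\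
    (forall S, is_cut n S -> cut_residual n.+2 S r' = cut_residual n.+2 S r - D)
  else r' = r.
Proof.
set W := n.+2; have nW : (n.+1 < W)%N by [].
move=> env D0; cbv zeta; set r := mat s W => r_ge0 V; rewrite /walk sem_seq.
rewrite -/walk_step_cmd.
set s1 := sem (Put vX _ _) s; set t := sem _ s1.
have dW u : (u < W)%N -> label s u <= W%:Z by move=> uW; apply: (labels_le nW V).
have E1 : flow_env n D s1 by case: env; split.
have X1 : cell s1 vX 0 = n%:Z by rewrite /= /upd /= (env_n env).
case: ifPn => [ds|]; last first.
  rewrite -leNgt => ds.
  pose Inv (k : nat) w := cell w vX 0 = n%:Z /\ cell w aR = cell s aR.
  suff [_ E] : Inv W t by rewrite /mat E.
  apply: for_rule => //.
  - exact: env_bound E1.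
  - by move=> w [C _ _ _]; rewrite /= (C vW isT) (env_W E1).
  move=> k w lt_k Sw Kw Iw.
  have Ew : flow_env n D w by apply: flow_env_same Sw _ E1.
  apply: (for_rule (m := W) (Inv := Inv)) => //.
  - exact: env_bound Ew.
  - by move=> w' [C _ _ _]; rewrite /= (C vW isT) (env_W Ew).
  move=> j x lt_j Sx Jx [Xx Rx].
  have Ex : flow_env n D x by apply: flow_env_same Sx _ Ew.
  have := walk_step_correct Ex Xx Jx (ltnW nW) lt_j.
  have Lx : label x n = label s n.
    have [C _ _ _] := Sx; have [C' _ _ _] := Sw.
    by rewrite /label (C aD isT) /= (C' aD isT).
  rewrite ifF; last by rewrite Lx; lia.
  by rewrite -/walk_step_cmd => ->.
pose Inv (f : nat -> Prop) w := exists x, [/\ cell w vX 0 = x%:Z,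
  walk_inv W n D r (label s) (mat w W) x & f x].
(* Each round lowers the current label by at least one unless it is already 1. Labels are at most W
   and stay positive along the walk, so W rounds lead to label 1, which only the sink has. *)
suff [x [Xx Wx dx]] :
    Inv (fun x => label s x <= 1 \/ label s x + W%:Z <= label s n) t.
  have xt : x = n.+1.
    case: (Wx) V => -[xW dxn] _ _ _ _ [_ _ dt _]; apply: dt => //.
    by have := dW n (ltnW nW); lia.
  by rewrite xt in Wx; apply: walk_end Wx.
apply: (for_rule (Inv := fun k => Inv (fun x => label s x <= 1 \/ label s x + k%:Z <= label s n)))
  => //.
- exact: env_bound E1.
- by move=> w [C _ _ _]; rewrite /= (C vW isT) (env_W E1).
- exists n; split=> //; last by right; rewrite addr0.
  exact: walk_start.
move=> k w lt_k Sw Kw [x0 [X0 W0 d0]].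
have Ew : flow_env n D w by apply: flow_env_same Sw _ E1.
have Lw u : label w u = label s u.
  by have [C _ _ _] := Sw; rewrite /label (C aD isT).
(* Scanning the candidates [v < j] has moved the walk strictly downhill as soon
   as one of them continues the walk from [x0]. *)
pose good v := [/\ (v < W)%N, 0 < label s v < label s x0 & D <= r x0 v].
suff [x [Xx Wx lt_x]] : Inv (fun x => label s x < label s x0 \/
    x = x0 /\ forall v, (v < W)%N -> ~ good v) (sem (For vV (`vW) walk_step_cmd) w).
  exists x; split=> //.
  case: (leP (label s x0) 1) => [d1|gt1].
    by left; case: lt_x => [lt_x|[->]] //; apply: ltW; apply: lt_le_trans d1.
  have [_ _ _ parent] := V; case: W0 => -[x0W _] _ _ _ _.
  have [v [vW dv rD]] := parent _ x0W gt1.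
  case: lt_x => [lt_x|[_ /(_ v vW)[]]]; last by split=> //; rewrite dv; lia.
  by right; lia.
apply: (for_rule (Inv := fun j => Inv (fun x => label s x < label s x0 \/
    x = x0 /\ forall v, (v < j)%N -> ~ good v))) => //.
- exact: env_bound Ew.
- by move=> w' [C _ _ _]; rewrite /= (C vW isT) (env_W Ew).
- by exists x0; split=> //; right.
move=> j w' lt_j Sx Jx [x [Xx Wx lt_x]].
have Ex : flow_env n D w' by apply: flow_env_same Sx _ Ew.
have Lx u : label w' u = label s u.
  by rewrite -Lw; have [C _ _ _] := Sx; rewrite /label (C aD isT).
have xW : (x < W)%N by case: Wx => -[].
have := walk_step_correct Ex Xx Jx xW lt_j.
rewrite !Lx; case: (boolP [&& _, _ & _]) => [/and3P[dj djx rD] [Xv Mv]|no ->].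
  exists j; split=> //.
    apply: eq_walk_inv (ltnW nW) (walk_step nW D0 Wx lt_j dj djx rD) => a b aW bW.
    exact: Mv.
  by left; case: lt_x => [/(lt_trans djx)|[<- _]].
exists x; split=> //; case: lt_x => [|[E ng]]; [by left | right; split=> //].
move=> v; rewrite ltnS leq_eqVlt => /orP[/eqP->|]; last exact: ng.
move=> [_ /andP[dj djx] rD]; case: Wx => _ _ _ _ [_ K].
(* Downhill arcs out of the current position still have their original residual capacity, so a
   candidate rejected now was no continuation in [r] either. *)
by case/and3P: no; split; rewrite ?E // -/W K // ?E //; lia.
Qed.

Definition good_cut (n : nat) (B : int) (r : nat -> nat -> int) :=
  exists2 S, is_cut n S & cut_residual n.+2 S r <= B.

Lemma augment_correct n D s : flow_env n D s -> 1 <= D ->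
  nonneg n.+2 (mat s n.+2) ->
  let r' := mat (sem (search ;; walk) s) n.+2 in
  flow_le n.+2 n (mat s n.+2) r' /\
  (good_cut n ((n.+2 * n.+2)%N%:Z * (D - 1)) r' \/
   forall S, is_cut n S ->
     cut_residual n.+2 S r' = cut_residual n.+2 S (mat s n.+2) - D).
Proof.
move=> env D1 r0 r'; rewrite {}/r' sem_seq.
have [V cl] := search_correct env; set t := sem search s in V cl *.
have nW : (n.+1 < n.+2)%N by [].
have St : same (mods search) s t by apply: sem_same.
have Et : flow_env n D t by apply: flow_env_same St _ env.
have Rt : mat t n.+2 = mat s n.+2.
  by have [C _ _ _] := St; rewrite /mat (C aR isT).
have := walk_correct Et (le_trans ler01 D1); rewrite Rt => /(_ r0 V).
case: ifPn => [_ [A B]|]; first by split=> //; right.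
rewrite -leNgt => ds ->; split; first exact: flow_le_refl.
by left; have [S Sc HS] := closed_cut nW V cl ds D1; exists S.
Qed.

Lemma max_flow_correct n D s :
  flow_env n D s -> powers s -> (n.+2 + n.+2 <= bound s)%N ->
  nonneg n.+2 (mat s n.+2) ->
  good_cut n ((n.+2 * n.+2)%N%:Z * (2 ^+ bound s - 1)) (mat s n.+2) ->
  let r' := mat (sem max_flow s) n.+2 in
  flow_le n.+2 n (mat s n.+2) r' /\ good_cut n 0 r'.
Proof.
move=> env Ps Nb r0 cut0 r'; rewrite {}/r'.
set W := n.+2 in r0 cut0 *; set r := mat s W in r0 cut0 *.
set W2 := (W * W)%N%:Z in cut0 *; set N := bound s in cut0 Nb *.
(* After k phases the last scale was D = 2^(N-k), and W^2 (D - 1) is what a failed search at that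
   scale certifies. For k = 0 this is the hypothesis on the initial network, and for k = N the bound
   is 0. *)
pose Inv k t := flow_le W n r (mat t W) /\ good_cut n (W2 * (2 ^+ (N - k) - 1)) (mat t W).
suff : Inv N (sem max_flow s) by rewrite /Inv subnn expr0 subrr mulr0.
apply: for_rule => //.
- by move=> t [_ B _ _]; rewrite /= B.
- by split; [apply: flow_le_refl | rewrite subn0].
move=> k t lt_k St Kt [Ft Ct].
pose d := 2 ^+ (N - k.+1) : int.
have d1 : 1 <= d by apply: exprn_ege1.
have d2 : 2 ^+ (N - k) = d + d.
  have -> : (N - k = (N - k.+1).+1)%N by lia.
  by rewrite exprS -/d; lia.
have Bt : bound t = N by have [_ B _ _] := St; rewrite B.
rewrite sem_seq; set t1 := sem (Put vDel _ _) t.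
have Dt : cell t1 vDel 0 = d.
  have [C _ _ _] := St.
  rewrite /t1 /= /upd /= Kt (C aPw isT) Bt.
  have -> : N%:Z - 1 - k%:Z = (N - k.+1)%N%:Z by lia.
  by apply: Ps; rewrite /N; lia.
have Et1 : flow_env n d t1.
  have [C B _ _] := St; case: env => e1 e2 e3 e4 _; split=> //.
  - by rewrite /= upd_other // (C vN isT).
  - by rewrite /= upd_other // (C vW isT).
  - by move=> u uW; rewrite /= upd_other // (C aRow isT) e3.
  - by rewrite /= Bt.
rewrite d2 in Ct.
(* Either some search at scale d has failed, and later augmentations only improve its cut, or all
   [m] attempts have succeeded and each has lowered the cut of the previous scale by d. *)
pose Inv1 m w := flow_le W n r (mat w W) /\
  exists2 S, is_cut n S & cut_residual W S (mat w W) <= W2 * (d - 1) \/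
    cut_residual W S (mat w W) <= W2 * (d + d - 1) - m%:Z * d.
suff [F1 [S Sc HS]] : Inv1 (N * N)%N
    (sem (For vT1 Bound (For vT2 Bound (search ;; walk))) t1).
  split=> //; exists S => //; case: HS => // HS.
  have := @cut_residual_ge0 W S (mat (sem (For vT1 Bound (For vT2 Bound (search ;; walk))) t1) W).
  case: (F1) => F0 _ _ _ /(_ F0) ge0.
  (* If all N^2 attempts had succeeded, the cut would have residual capacity at most W^2 (2d - 1) -
     2 W^2 d, which is negative. *)
  have NN : 2 * W2 <= (N * N)%N%:Z by rewrite /W2 /W; nia.
  suff : (N * N)%N%:Z * d >= 2 * W2 * d by rewrite /W2 in HS *; nia.
  by rewrite ler_pM2r //; lia.
apply: (for_rule (Inv := fun i w => Inv1 (i * N)%N w)) => //.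
- by rewrite /= Bt.
- by move=> w [_ B _ _]; rewrite /= B // /= Bt.
- by case: Ct => S Sc HS; split=> //; exists S => //; right; rewrite mul0n mul0r subr0.
move=> i w lt_i Sw Iw Hw; rewrite mulSn addnC.
have Ew : flow_env n d w by apply: flow_env_same Sw _ Et1.
have Bw : bound w = N by have [_ B _ _] := Sw; rewrite B //= Bt.
apply: (for_rule (Inv := fun j w => Inv1 (i * N + j)%N w)) => //.
- by rewrite Bw.
- by move=> x [_ B _ _]; rewrite /= B // Bw.
- by rewrite addn0.
move=> j x lt_j Sx Jx [Fx [S Sc HS]].
have Ex : flow_env n d x by apply: flow_env_same Sx _ Ew.
have [|Fx' Cx] := augment_correct Ex d1; first by case: Fx.
split; first exact: flow_le_trans Fx Fx'.
case: Cx => [[S' Sc' HS']|Cx]; first by exists S' => //; left.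
exists S => //; rewrite [cut_residual _ _ _]Cx //.
move: HS; rewrite -/r -/W; set q := cut_residual _ _ _; clearbody q d.
case=> HS; [left; lia|right].
by rewrite addnS -addn1 PoszD mulrDl mul1r; lia.
Qed.

(** * Correctness of input, network construction and output *)

(* An entry of the input is [None] for a priceable vertex, else its cost. *)
Definition entry : Type := option (int * int).
Definition encode_entry (x : entry) : seq int :=
  if x is Some (p, q) then [:: 0; p; q] else [:: 1].
Definition entry_num (x : entry) : int := if x is Some (p, _) then p else 0.
Definition entry_den (x : entry) : int := if x is Some (_, q) then q else 1.
Definition entry_bits (x : entry) : nat :=
  if x is Some (p, q) then (up_log 2 (pos_part p) + up_log 2 (pos_part q))%N else 0%N.

Definition vertices_read (xs : seq entry) (k : nat) (t : store) :=
  forall i, (i < k)%N ->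
    [/\ cell t aIsp i%:Z = (nth None xs i == None)%:Z,
        cell t aNum i%:Z = entry_num (nth None xs i) &
        cell t aDen i%:Z = entry_den (nth None xs i)].

Lemma read_vertices_correct xs rest s :
  cell s vN 0 = (size xs)%:Z -> (size xs <= bound s)%N ->
  input s = flatten (map encode_entry xs) ++ rest ->
  let t := sem read_vertices s in
  [/\ input t = rest, bound t = (bound s + \sum_(x <- xs) entry_bits x)%N &
      vertices_read xs (size xs) t].
Proof.
move=> Ns Nb Hin t; rewrite {}/t /read_vertices.
set t := sem _ s.
suff : [/\ input t = flatten (map encode_entry (drop (size xs) xs)) ++ rest,
    bound t = (bound s + \sum_(x <- take (size xs) xs) entry_bits x)%N &
    vertices_read xs (size xs) t].
  by rewrite drop_size take_size.
apply: (for_rule (Inv := fun k t =>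
  [/\ input t = flatten (map encode_entry (drop k xs)) ++ rest,
    bound t = (bound s + \sum_(x <- take k xs) entry_bits x)%N &
    vertices_read xs k t])) => //.
- by move=> w [C _ _ _]; rewrite /= (C vN isT).
- by split=> //; rewrite ?drop0 ?take0 ?big_nil ?addn0.
move=> {t} k t lt_k _ Kt [It Bt Vt].
rewrite (take_nth None) // big_rcons /= addnA -Bt.
rewrite (drop_nth None) //= in It.
have up_old a i z m : (i < k)%N -> upd m a k%:Z z a i%:Z = m a i%:Z.
  by move=> lt_i; rewrite /upd eqxx eqz_nat ltn_eqF.
case E: (nth None xs k) It => [[p q]|] /= It; rewrite It /= /upd /= Kt ?eqxx /=; split=> //.
- by rewrite addnA.
- move=> i; rewrite ltnS leq_eqVlt => /orP[/eqP-> | lt_i].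
    by rewrite E /= /upd /= eqxx.
  by rewrite /= /upd /= eqz_nat ltn_eqF //; have [-> -> ->] := Vt i lt_i.
- by rewrite addn0.
move=> i; rewrite ltnS leq_eqVlt => /orP[/eqP-> | lt_i].
  by rewrite E /= /upd /= eqxx.
by rewrite /= /upd /= eqz_nat ltn_eqF //; have [-> -> ->] := Vt i lt_i.
Qed.

Record ready (nA nB : nat) (xs : seq entry) (s : store) : Prop := Ready {
  ready_A : cell s vA 0 = nA%:Z;
  ready_B : cell s vB 0 = nB%:Z;
  ready_env : flow_env (nA + nB) (cell s vDel 0) s;
  ready_powers : powers s;
  ready_isp : forall i, (i < nA + nB)%N -> cell s aIsp i%:Z = (nth None xs i == None)%:Z;
  ready_bound : bound s = ((nA + nB).+2 + (nA + nB).+2 + \sum_(x <- xs) entry_bits x)%N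
}.

Lemma setup_correct nA nB xs adjs :
  size xs = (nA + nB)%N ->
  let t := sem setup (start (nA%:Z :: nB%:Z :: flatten (map encode_entry xs) ++ adjs)) in
  [/\ ready nA nB xs t, input t = adjs, output t = [::],
      cell t aR = (fun=> 0) &
      cell t aNum (nA + nB)%N%:Z = 1 /\
      forall i, (i < nA + nB)%N ->
        cell t aNum i%:Z = entry_num (nth None xs i) /\
        cell t aDen i%:Z = entry_den (nth None xs i)].
Proof.
set n := (nA + nB)%N => sz t; rewrite {}/t /setup.
set s0 := start _.
rewrite 6!sem_seq; set s1 := sem (AddBound _) _.
have nE : nA%:Z + nB%:Z = n%:Z by rewrite -PoszD.
have [A1 B1 N1 W1] : [/\ cell s1 vA 0 = nA%:Z, cell s1 vB 0 = nB%:Z,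
    cell s1 vN 0 = n%:Z & cell s1 vW 0 = n.+2%:Z].
  by split; rewrite /s1 /= /upd /= ?nE //; lia.
have b1 : bound s1 = (n.+2 + n.+2)%N.
  by rewrite /s1 /= /upd /= nE /pos_part; case: ifP; lia.
have I1 : input s1 = flatten (map encode_entry xs) ++ adjs by [].
have O1 : output s1 = [::] by [].
have R1 : cell s1 aRow 0 = 0 by [].
have Z1 : cell s1 aR = (fun=> 0) by [].
clearbody s1; rewrite sem_seq; set s2 := sem (For vI _ _) s1.
have S2 : same [:: aRow; vI] s1 s2.
  by apply: same_sub (sem_same _ s1) => a; rewrite !inE => /or3P[]->; rewrite ?orbT.
have [C2 B2 In2 O2] := S2.
have R2 : forall u, (u < n.+3)%N -> cell s2 aRow u%:Z = (u * n.+2)%N%:Z.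
  apply: (for_rule (m := n.+2) (Inv := fun k t => forall u, (u < k.+1)%N ->
    cell t aRow u%:Z = (u * n.+2)%N%:Z)) => //.
  - by rewrite b1; lia.
  - by move=> t [C _ _ _]; rewrite /= (C vW isT) W1.
  - by case.
  move=> k t lt_k [C _ _ _] Kt H u; rewrite ltnS leq_eqVlt => lt_u.
  rewrite /= /upd /= Kt (C vW isT) W1 (H k) // -!PoszD addn1 eqz_nat.
  by case: eqP lt_u => [-> _|_ lt_u]; [rewrite mulSn addnC | apply: H].
rewrite sem_seq.
have [|||I3 b3 V3] := @read_vertices_correct xs adjs s2.
- by rewrite (C2 vN isT) N1 sz.
- by rewrite B2 // b1 sz; lia.
- by rewrite In2.
set s3 := sem read_vertices s2 in I3 b3 V3 *.
have [C3 _ _ O3] : same [:: 0%N; 1%N; aIsp; aNum; aDen; vI] s2 s3.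
  apply: same_sub (sem_same read_vertices s2) => a.
  by move: a; apply/allP.
rewrite 2!sem_seq; set s4 := sem (Put aPw _ _) _.
set s5 := sem (For vK _ _) s4.
have [C5 B5 In5 O5] : same [:: aPw; vK] s4 s5.
  by apply: same_sub (sem_same _ s4) => a; rewrite !inE => /or3P[]->; rewrite ?orbT.
have b5 : bound s5 = (n.+2 + n.+2 + \sum_(x <- xs) entry_bits x)%N.
  by rewrite B5 // -b1 -B2 // -b3.
have P5 : forall u, (u < (bound s4).+1)%N -> cell s5 aPw u%:Z = 2 ^+ u.
  apply: (for_rule (Inv := fun k t => forall u, (u < k.+1)%N ->
    cell t aPw u%:Z = 2 ^+ u)) => //.
  - by move=> t [_ B _ _]; rewrite /= B.
  - by case.
  move=> k t lt_k _ Kt H u; rewrite ltnS leq_eqVlt => lt_u.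
  rewrite /= /upd /= Kt (H k) // -!PoszD addn1 eqz_nat.
  case: eqP lt_u => [-> _|_ lt_u]; last exact: H.
  by rewrite exprS; lia.
have C a : a \in [:: vA; vB; vN; vW; aR] -> cell s5 a = cell s1 a.
  by rewrite !inE => /or4P[||| /orP[]] /eqP->;
    rewrite C5 //= !upd_other // C3 // C2.
split.
- split.
  + by rewrite C.
  + by rewrite C.
  + split=> //.
    * by rewrite C.
    * by rewrite C.
    * move=> u uW; rewrite (C5 aRow isT) /= upd_other //= upd_other //= (C3 aRow isT) R2 //.
      exact: ltnW.
    * by rewrite b5; lia.
  + by move=> u; rewrite [bound s5]B5 // => le_u; apply: P5.
  + move=> i lt_i; rewrite (C5 aIsp isT) /= /upd /=.
    by have [|->] := V3 i; rewrite ?sz.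
  + exact: b5.
- by rewrite In5.
- by rewrite O5 //= O3 // O2.
- by rewrite C.
have N3 : cell s3 vN 0 = n%:Z by rewrite (C3 vN isT) (C2 vN isT).
split=> [|i lt_i]; rewrite (C5 aNum isT) ?(C5 aDen isT) /= /upd /= N3 eqz_nat ?eqxx //.
by have [|_ -> ->] := V3 i; rewrite ?sz // ltn_eqF.
Qed.

Lemma big_capacity_correct nA nB s :
  cell s vA 0 = nA%:Z -> cell s vB 0 = nB%:Z -> (nB <= bound s)%N ->
  cell (sem big_capacity s) vM 0 = 1 + \sum_(j < nB) cell s aCap (nA + j)%N%:Z.
Proof.
move=> As Bs Nb; rewrite /big_capacity sem_seq; set s1 := sem (Put _ _ _) s.
apply: (for_rule (Inv := fun k t =>
  cell t vM 0 = 1 + \sum_(j < k) cell s aCap (nA + j)%N%:Z)) => //.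
- by move=> t [C _ _ _]; rewrite /= (C vB isT).
- by rewrite big_ord0 addr0.
move=> k t lt_k [C _ _ _] Kt H.
by rewrite big_ord_recr /= /upd /= H Kt (C vA isT) (C aCap isT) /= /upd /= As addrA.
Qed.

Definition network (nA nB : nat) (adjs : seq int) (cap : nat -> int) (M : int)
    (u v : nat) : int :=
  if (u < nA)%N && (nA <= v < nA + nB)%N
  then if 0 < nth 0 adjs (u * nB + (v - nA)) then M else 0
  else if (u == nA + nB)%N && (v < nA)%N then cap v
  else if (nA <= u < nA + nB)%N && (v == (nA + nB).+1) then cap u
  else 0.

Lemma build_network_correct nA nB adjs D s :
  cell s vA 0 = nA%:Z -> cell s vB 0 = nB%:Z -> flow_env (nA + nB) D s ->
  cell s aR = (fun=> 0) -> input s = adjs ->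
  forall u v, (u < (nA + nB).+2)%N -> (v < (nA + nB).+2)%N ->
  mat (sem build_network s) (nA + nB).+2 u v
  = network nA nB adjs (fun i => cell s aCap i%:Z) (cell s vM 0) u v.
Proof.
set n := (nA + nB)%N => As Bs env Zs Is.
rewrite /build_network 2!sem_seq; set W := n.+2.
set s1 := sem (For vI _ _) s; set s2 := sem _ s1; set s3 := sem _ s2.
pose e u v : int := if 0 < nth 0 adjs (u * nB + (v - nA)) then cell s vM 0 else 0.
have bA : (nA <= bound s)%N by have := env_bound env; rewrite /n; lia.
have bB : (nB <= bound s)%N by have := env_bound env; rewrite /n; lia.
have M1 : input s1 = drop (nA * nB) adjs /\ forall u v, (u < W)%N -> (v < W)%N ->
    mat s1 W u v = if (u < nA)%N && (nA <= v < n)%N then e u v else 0.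
  apply: (for_rule (Inv := fun k t => input t = drop (k * nB) adjs /\
    forall u v, (u < W)%N -> (v < W)%N ->
    mat t W u v = if (u < k)%N && (nA <= v < n)%N then e u v else 0)) => //.
  - by move=> t [C _ _ _]; rewrite /= (C vA isT).
  - by rewrite mul0n drop0; split=> // u v _ _; rewrite /mat /= upd_other // Zs.
  move=> k t lt_k St Kt [It Mt].
  have [Ct Bt _ _] := St; have Et := flow_env_same St isT env.
  rewrite mulSn addnC.
  suff [It' Mt'] : input (sem (For vJ (`vB)
       (Input vF (Cst 0) ;; WHEN `vF (Put aR (aRow![`vI] :+ (`vA :+ `vJ)) (`vM)))) t)
      = drop (k * nB + nB) adjs /\
    forall u v, (u < W)%N -> (v < W)%N ->
    mat (sem (For vJ (`vB)
       (Input vF (Cst 0) ;; WHEN `vF (Put aR (aRow![`vI] :+ (`vA :+ `vJ)) (`vM)))) t) W u v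
      = if ((u < k) && (nA <= v < n) || (u == k) && (nA <= v < nA + nB))%N
        then e u v else 0.
    split=> // u v uW vW; rewrite [mat _ _ _ _]Mt' // -/n.
    by congr (if _ then _ else _); lia.
  apply: (for_rule (Inv := fun j x => input x = drop (k * nB + j) adjs /\
    forall u v, (u < W)%N -> (v < W)%N -> mat x W u v =
      if ((u < k) && (nA <= v < n) || (u == k) && (nA <= v < nA + j))%N
      then e u v else 0)) => //.
  - by rewrite Bt.
  - by move=> x [C _ _ _]; rewrite /= (C vB isT) (Ct vB isT).
  - rewrite addn0; split=> // u v uW vW; rewrite [mat _ _ _ _]Mt //.
    by congr (if _ then _ else _); lia.
  move=> j x lt_j Sx Jx [Ix Mx].
  have [Cx _ _ _] := Sx.
  have x1 : cell x vI 0 = k%:Z by rewrite (Cx vI isT).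
  have x2 : cell x vA 0 = nA%:Z by rewrite (Cx vA isT) (Ct vA isT).
  have x3 : cell x aRow k%:Z = (k * W)%N%:Z.
    by rewrite (Cx aRow isT) (env_row Et) // /n; lia.
  have x4 : cell x vM 0 = cell s vM 0 by rewrite (Cx vM isT) (Ct vM isT).
  have hd : head 0 (input x) = nth 0 adjs (k * nB + j).
    by rewrite -nth0 Ix nth_drop addn0.
  have bh : behead (input x) = drop (k * nB + j.+1) adjs.
    by rewrite Ix -drop1 drop_drop add1n addnS.
  rewrite sem_seq; set x' := sem (Input _ _) x.
  have Ix' : input x' = drop (k * nB + j.+1) adjs by rewrite -bh.
  have Fx' : eval x' (`vF) = nth 0 adjs (k * nB + j) by rewrite -hd.
  have Mx' : mat x' = mat x by [].
  rewrite sem_if Fx'.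
  case: ifP => pos.
    have -> : sem (Put aR (aRow![`vI] :+ (`vA :+ `vJ)) (`vM)) x'
        = put aR (k * W + (nA + j))%N%:Z (cell s vM 0) x'.
      by rewrite -x4 !PoszD -x3 -x2 -Jx -x1.
    split=> // u v uW vW.
    rewrite -[mat _ W u v]/(mat (put aR (k * W + (nA + j))%N%:Z (cell s vM 0) x') W u v).
    rewrite mat_put //; last by rewrite /W /n; lia.
    case: ifP => [/andP[/eqP-> /eqP->]|ne].
      by rewrite ifT; [rewrite /e addKn pos | lia].
    by rewrite Mx' Mx //; congr (if _ then _ else _); lia.
  split=> // u v uW vW; rewrite [mat _ W u v]Mx //.
  case: (boolP ((u == k) && (v == nA + j)%N)) => [/andP[/eqP-> /eqP->]|ne].
    by rewrite ifF; [rewrite ifT; [rewrite /e addKn pos | lia] | lia].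
  by congr (if _ then _ else _); lia.
have {M1} M1 := M1.2.
have S1 : same [:: 1%N; vF; aR; vI; vJ] s s1.
  by apply: same_sub (sem_same _ s) => a; move: a; apply/allP.
have [C1 B1 _ _] := S1; have E1 := flow_env_same S1 isT env.
have M2 : forall u v, (u < W)%N -> (v < W)%N ->
    mat s2 W u v = if (u == n) && (v < nA)%N then cell s aCap v%:Z else mat s1 W u v.
  apply: (for_rule (Inv := fun k t => forall u v, (u < W)%N -> (v < W)%N ->
    mat t W u v = if (u == n) && (v < k)%N then cell s aCap v%:Z else mat s1 W u v)) => //.
  - by rewrite B1.
  - by move=> t [C _ _ _]; rewrite /= (C vA isT) (C1 vA isT).
  - by move=> u v uW vW; rewrite ltn0 andbF.
  move=> k t lt_k St Kt Mt u v uW vW.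
  have [Ct _ _ _] := St; have Et := flow_env_same St isT E1.
  have -> : sem (Put aR (aRow![`vN] :+ `vI) (aCap![`vI])) t
      = put aR (n * W + k)%N%:Z (cell s aCap k%:Z) t.
    by rewrite PoszD -(env_row Et) // -(env_n Et) -Kt -(C1 aCap isT) -(Ct aCap isT).
  rewrite -[mat _ W u v]/(mat (put aR (n * W + k)%N%:Z (cell s aCap k%:Z) t) W u v).
  rewrite mat_put //; last by rewrite /W /n; lia.
  case: ifP => [/andP[/eqP-> /eqP->]|ne]; first by rewrite eqxx ltnSn.
  by rewrite Mt //; congr (if _ then _ else _); lia.
have S2 : same [:: aR; vI] s1 s2.
  by apply: same_sub (sem_same _ s1) => a; move: a; apply/allP.
have [C2 B2 _ _] := S2; have E2 := flow_env_same S2 isT E1.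
have M3 : forall u v, (u < W)%N -> (v < W)%N ->
    mat s3 W u v = if (nA <= u < nA + nB)%N && (v == n.+1) then cell s aCap u%:Z else mat s2 W u v.
  apply: (for_rule (Inv := fun k t => forall u v, (u < W)%N -> (v < W)%N ->
    mat t W u v = if (nA <= u < nA + k)%N && (v == n.+1) then cell s aCap u%:Z else mat s2 W u v)) => //.
  - by rewrite B2 // B1.
  - by move=> t [C _ _ _]; rewrite /= (C vB isT) (C2 vB isT) (C1 vB isT).
  - by move=> u v uW vW; rewrite ifF //; lia.
  move=> k t lt_k St Kt Mt u v uW vW.
  have [Ct _ _ _] := St; have Et := flow_env_same St isT E2.
  have At : cell t vA 0 = nA%:Z by rewrite (Ct vA isT) (C2 vA isT) (C1 vA isT).
  have kW : (nA + k < W)%N by rewrite /W /n; lia.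
  have -> : sem (Put aR (aRow![`vA :+ `vJ] :+ (`vN :+ one)) (aCap![`vA :+ `vJ])) t
      = put aR ((nA + k) * W + n.+1)%N%:Z (cell s aCap (nA + k)%N%:Z) t.
    have e1 : n.+1%:Z = n%:Z + 1 by lia.
    have e2 : (nA + k)%N%:Z = nA%:Z + k%:Z by lia.
    rewrite PoszD -(env_row Et) // e1 e2 -(env_n Et) -Kt -At.
    by rewrite -(C1 aCap isT) -(C2 aCap isT) -(Ct aCap isT).
  rewrite -[mat _ W u v]/(mat (put aR ((nA + k) * W + n.+1)%N%:Z
    (cell s aCap (nA + k)%N%:Z) t) W u v).
  rewrite mat_put //.
  case: ifP => [/andP[/eqP-> /eqP->]|ne]; first by rewrite ifT //; lia.
  by rewrite Mt //; congr (if _ then _ else _); lia.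
move=> u v uW vW; rewrite M3 // M2 // M1 // /network -/n -/(e u v).
case: ifP => c3; case: ifP => c1 //; try by lia.
- by case: ifP => // c2; lia.
case: ifP => // c2; lia.
Qed.

Definition with_supply (nA n : nat) (prc : pred nat) (M : int)
    (r : nat -> nat -> int) (u v : nat) : int :=
  if [&& u == n, (v < nA)%N & prc v] then M else r u v.

Lemma enable_correct nA nB D s :
  cell s vA 0 = nA%:Z -> flow_env (nA + nB) D s ->
  forall u v, (u < (nA + nB).+2)%N -> (v < (nA + nB).+2)%N ->
  mat (sem enable_priceable s) (nA + nB).+2 u v
  = with_supply nA (nA + nB) (fun i => 0 < cell s aIsp i%:Z) (cell s vM 0)
      (mat s (nA + nB).+2) u v.
Proof.
set n := (nA + nB)%N; set W := n.+2 => As env.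
apply: (for_rule (Inv := fun k t => forall u v, (u < W)%N -> (v < W)%N ->
  mat t W u v = with_supply k n (fun i => 0 < cell s aIsp i%:Z) (cell s vM 0)
    (mat s W) u v)) => //.
- by have := env_bound env; rewrite /n; lia.
- by move=> t [C _ _ _]; rewrite /= (C vA isT).
- by move=> u v uW vW; rewrite /with_supply ltn0 andbF.
move=> k t lt_k St Kt Mt u v uW vW.
have [Ct _ _ _] := St; have Et := flow_env_same St isT env.
rewrite -[mat (put _ _ _ _) W u v]/(mat (sem _ t) W u v).
have e1 : eval t (aIsp![`vI]) = cell s aIsp k%:Z by rewrite /= Kt (Ct aIsp isT).
rewrite sem_if e1; case: ifP => pk.
  have -> : sem (Put aR (aRow![`vN] :+ `vI) (`vM)) t
      = put aR (n * W + k)%N%:Z (cell s vM 0) t.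
    by rewrite PoszD -(env_row Et) // -(env_n Et) -Kt -(Ct vM isT).
  rewrite mat_put //; last by rewrite /W /n; lia.
  case: ifP => [/andP[/eqP-> /eqP->]|ne]; first by rewrite /with_supply eqxx ltnSn pk.
  by rewrite Mt // /with_supply; congr (if _ then _ else _); lia.
rewrite [mat _ W u v]Mt // /with_supply.
case: (v =P k) => [->|ne]; first by rewrite pk !andbF.
by congr (if _ then _ else _); lia.
Qed.

Lemma write_prices_correct nA nB D s :
  cell s vA 0 = nA%:Z -> flow_env (nA + nB) D s ->
  output (sem write_prices s) = output s ++
    flatten [seq [:: mat s (nA + nB).+2 i (nA + nB); cell s aCap (nA + nB)%N%:Z]
            | i <- iota 0 nA & 0 < cell s aIsp i%:Z].
Proof.
set n := (nA + nB)%N; set W := n.+2 => As env.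
apply: (for_rule (Inv := fun k t => output t = output s ++
  flatten [seq [:: mat s W i n; cell s aCap n%:Z]
            | i <- iota 0 k & 0 < cell s aIsp i%:Z])) => //.
- by have := env_bound env; rewrite /n; lia.
- by move=> t [C _ _ _]; rewrite /= (C vA isT).
- by rewrite cats0.
move=> k t lt_k St Kt Ot.
have [Ct _ _ _] := St; have Et := flow_env_same St isT env.
have -> : iota 0 k.+1 = iota 0 k ++ [:: k] by rewrite -addn1 iotaD.
rewrite filter_cat map_cat flatten_cat catA -Ot /=.
rewrite Kt (Ct aIsp isT) (Ct aCap isT) (Ct aR isT) (Ct aRow isT) (Ct vN isT).
case: ifP => //= _; last by rewrite cats0.
rewrite (env_row env) //; last by rewrite /n; lia.
by rewrite (env_n env) -PoszD -!cats1 -catA.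
Qed.

Lemma eq_flow_le W s r r1 r' : (s.+1 < W)%N ->
  (forall u v, (u < W)%N -> (v < W)%N -> r u v = r1 u v) ->
  flow_le W s r r' -> flow_le W s r1 r'.
Proof.
move=> sW E [A B C D]; split=> // [u v uW vW|u uW us ut|u uW].
- by rewrite B // !E.
- by rewrite C //; apply: eq_bigr => v _; apply: E.
- by rewrite -E ?D //; lia.
Qed.

Lemma pos_part_le (z : int) : z <= 2 ^+ up_log 2 (pos_part z).
Proof.
have := @up_logP 2 (pos_part z) isT; rewrite /pos_part; case: ifP => [z0|]; last first.
  by move=> z0 _; apply: le_trans (exprn_ge0 _ _); lia.
move=> H; have -> : (2 : int) ^+ up_log 2 `|z|%N = (2 ^ up_log 2 `|z|)%N%:Z.
  by rewrite -natrX natz.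
lia.
Qed.

Lemma eq_network nA nB adjs cap cap' M u v :
  (forall i, (i < nA + nB)%N -> cap i = cap' i) ->
  network nA nB adjs cap M u v = network nA nB adjs cap' M u v.
Proof.
move=> E; rewrite /network; case: ifP => // _.
case: ifP => [/andP[_ lt_v]|_]; first by rewrite E //; lia.
by case: ifP => // /andP[/andP[_ lt_u] _]; rewrite E.
Qed.

Lemma eq_with_supply nA n p q M r u v :
  (forall i, (i < nA)%N -> p i = q i) ->
  with_supply nA n p M r u v = with_supply nA n q M r u v.
Proof.
move=> E; rewrite /with_supply; case: (v < nA)%N (E v) => [-> //|_].
by rewrite !andbF.
Qed.

Lemma flow_env_frame n D c s :
  all (fun a => a \notin mods c) [:: vN; vW; aRow; 0%N] ->
  flow_env n D s -> flow_env n (cell (sem c s) vDel 0) (sem c s).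
Proof.
have [C B _ _] := sem_same c s.
move=> /and4P[l1 l2 l3 /andP[l4 _]] [e1 e2 e3 e4 e5].
by split; rewrite ?(C _ l1) ?(C _ l2) ?(C _ l3) ?B.
Qed.

(** The cut that separates the sink alone starts the scaling: only capacities of B cross it, so the
    size of [infinity] does not affect the initial scale. *)
Lemma sink_cut n (B : int) r : 0 <= B ->
  (forall u, (u < n.+1)%N -> r u n.+1 <= B) -> good_cut n ((n.+2 * n.+2)%N%:Z * B) r.
Proof.
move=> B0 rB; exists (pred1 n.+1); first by split; rewrite /= ?eqxx // ltn_eqF.
apply: cut_residual_le => // u v uW vW /= u1 /eqP ->; apply: rB; lia.
Qed.

(** * The complete run of the pricing program *)

Section Pricing.
Variables (nA nB : nat) (xs : seq entry) (adjs : seq int).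
Local Notation n := (nA + nB)%N.
Local Notation W := n.+2.
Let x i := nth None xs i.
Hypothesis sz : size xs = n.
Hypothesis num0 : forall i, (i < n)%N -> 0 <= entry_num (x i).
Hypothesis den0 : forall i, (i < n)%N -> 0 < entry_den (x i).

Let prc : pred nat := fun i => x i == None.
Definition capacity (v : nat) : int :=
  entry_num (x v) * prod_others (fun u => entry_den (x u)) n v.
Definition denominator : int := \prod_(u < n) entry_den (x u).
Definition infinity : int := 1 + \sum_(j < nB) capacity (nA + j).
Let N := (W + W + \sum_(y <- xs) entry_bits y)%N.

Lemma entry_bounds u : (u < n)%N ->
  0 <= entry_num (x u) <= 2 ^+ entry_bits (x u) /\
  0 <= entry_den (x u) <= 2 ^+ entry_bits (x u).
Proof.
move=> un; have := num0 un; have := den0 un.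
case: (x u) => [[p q]|] //= q0 p0.
rewrite p0 (ltW q0) exprD /=; have := pos_part_le p; have := pos_part_le q.
have : (1 : int) <= 2 ^+ up_log 2 (pos_part p) by apply: exprn_ege1.
have : (1 : int) <= 2 ^+ up_log 2 (pos_part q) by apply: exprn_ege1.
by move: (2 ^+ _) (2 ^+ _) => a b; nia.
Qed.

Let bitsE : (\sum_(y <- xs) entry_bits y = \sum_(u < n) entry_bits (x u))%N.
Proof. by rewrite (big_nth None) big_mkord sz. Qed.

Lemma entry_den_bounds u : (u < n)%N -> 0 <= entry_den (x u) < 2 ^+ N.
Proof.
move=> un; have [_ /andP[-> le_u]] := entry_bounds un; apply: le_lt_trans le_u _.
rewrite ltr_eXn2l // /N bitsE (bigD1 (Ordinal un)) //=; lia.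
Qed.

(** A capacity is a product with one factor per vertex, the numerator of [v] and the denominators of
    the others. Digit counts add up under products, so the loop bound is also a bound on the digits
    of every capacity. *)
Lemma capacity_bounds v : (v < n)%N -> 0 <= capacity v <= 2 ^+ N - 1.
Proof.
move=> vn.
have -> : capacity v
    = \prod_(u < n) (if u == v :> nat then entry_num (x v) else entry_den (x u)).
  rewrite /capacity /prod_others (bigD1 (Ordinal vn)) //= [RHS](bigD1 (Ordinal vn)) //= !eqxx.
  rewrite mul1r; congr (_ * _); apply: eq_bigr => u ne.
  have -> : (u == v :> nat) = false; last by [].
  by apply: contraNF ne => /eqP uv; apply/eqP/val_inj.
have fac (u : 'I_n) : 0 <= (if u == v :> nat then entry_num (x v) else entry_den (x u))
    <= 2 ^+ entry_bits (x u).
  by have := entry_bounds (ltn_ord u); case: eqP => [<-|_] [].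
apply/andP; split; first by apply: prodr_ge0 => u _; case/andP: (fac u).
apply: (@le_trans _ _ (2 ^+ (\sum_(y <- xs) entry_bits y)%N)).
  rewrite bitsE expr_sum; apply: ler_prod => u _; exact: fac.
set m := (\sum_(_ <- _) _)%N.
have -> : N = (n + W + m).+2 by rewrite /N -/m; lia.
set k := (n + W + m).+1; rewrite exprS.
have : (2 : int) ^+ m <= 2 ^+ k by apply: ler_weXn2l => //; rewrite /k; lia.
have : (1 : int) <= 2 ^+ k by apply: exprn_ege1.
lia.
Qed.

Lemma denominator_gt0 : 0 < denominator.
Proof. by apply: prodr_gt0 => u _; apply: den0. Qed.

Definition instance_network := network nA nB adjs capacity infinity.

Lemma infinity_gt0 : 0 < infinity.
Proof.
suff : 0 <= \sum_(j < nB) capacity (nA + j) by rewrite /infinity; lia.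
by apply: sumr_ge0 => j _; case/andP: (@capacity_bounds (nA + j) ltac:(have := ltn_ord j; lia)).
Qed.

Lemma instance_network_ge0 : nonneg W instance_network.
Proof.
move=> u v uW vW; rewrite /instance_network /network.
have iF := infinity_gt0; have cB := capacity_bounds.
case: ifP => _; first by case: ifP => // _; lia.
case: ifP => [/andP[_ lt_v]|_]; first by have := cB v ltac:(lia); lia.
by case: ifP => // /andP[/andP[_ lt_u] _]; have := cB u lt_u; lia.
Qed.

Lemma instance_network_sink u : (u < W)%N -> instance_network n.+1 u = 0.
Proof.
move=> uW; rewrite /instance_network /network.
by do 3?[rewrite ifF; last by lia].
Qed.

Lemma instance_network_to_sink u :
  instance_network u n.+1 = if (nA <= u < n)%N then capacity u else 0.
Proof.
rewrite /instance_network /network.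
by do 2?[rewrite ifF; last by lia]; rewrite eqxx andbT.
Qed.

(** This is all that optimality needs to know about the run: two successive flows, each proved
    maximum by a cut without residual capacity, with the priceable supplies raised in between. *)
Lemma pricing_correct :
  let fin := sem pricing
    (start (nA%:Z :: nB%:Z :: flatten (map encode_entry xs) ++ adjs)) in
  bound fin = N /\
  exists r1 r2, [/\ flow_le W n instance_network r1, good_cut n 0 r1,
    flow_le W n (with_supply nA n prc infinity r1) r2, good_cut n 0 r2 &
    output fin = flatten [seq [:: r2 i n; denominator] | i <- iota 0 nA & prc i]].
Proof.
have NW : (W + W <= N)%N by apply: leq_addr.
have [nBN nN] : (nB <= N)%N /\ (n < N)%N by clear -NW; move: NW; lia.
have infA i : (i < nA)%N -> (i < n)%N by clear; lia.
have infB (j : 'I_nB) : (nA + j < n)%N by rewrite ltn_add2l.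
have n1 u : (u < n.+1)%N -> (u < W)%N by apply: ltnW.
move=> fin; rewrite {}/fin.
pose s0 := start (nA%:Z :: nB%:Z :: flatten (map encode_entry xs) ++ adjs).
rewrite -/s0.
(* The intermediate stores are kept abstract, so that conversion cannot run
   the program. *)
have abs c s : exists2 t, t = sem c s & same (mods c) s t.
  by exists (sem c s); last exact: sem_same.
have [s1 e1 _] := abs setup s0.
have [s2 e2 [C2 b2 I2 O2]] := abs common_denominator s1.
have [s3 e3 [C3 b3 I3 O3]] := abs big_capacity s2.
have [s4 e4 [C4 b4 _ O4]] := abs build_network s3.
have [s5 e5 [C5 b5 _ O5]] := abs max_flow s4.
have [s6 e6 [C6 b6 _ O6]] := abs enable_priceable s5.
have [s7 e7 [C7 b7 _ O7]] := abs max_flow s6.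
have [s8 e8 [_ b8 _ _]] := abs write_prices s7.
have -> : sem pricing s0 = s8.
  by rewrite e8 e7 e6 e5 e4 e3 e2 e1 -!sem_seq.
have := setup_correct adjs sz; rewrite -/s0 -e1.
case=> [[A1 B1 E1 P1 isp1 b1] I1 O1 R1 [numn nums]].
have E2 := flow_env_frame (c := common_denominator) isT E1; rewrite -e2 in E2.
have E3 := flow_env_frame (c := big_capacity) isT E2; rewrite -e3 in E3.
have E4 := flow_env_frame (c := build_network) isT E3; rewrite -e4 in E4.
have E5 := flow_env_frame (c := max_flow) isT E4; rewrite -e5 in E5.
have E6 := flow_env_frame (c := enable_priceable) isT E5; rewrite -e6 in E6.
have E7 := flow_env_frame (c := max_flow) isT E6; rewrite -e7 in E7.
have N1 : bound s1 = N := b1.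
have Ns i : (i < n)%N -> cell s1 aNum i%:Z = entry_num (x i) by move=> /nums[].
have Ds i : (i < n)%N -> cell s1 aDen i%:Z = entry_den (x i) by move=> /nums[].
have den_bd u : (u < n)%N -> 0 <= cell s1 aDen u%:Z < 2 ^+ bound s1.
  by move=> lt_u; rewrite Ds // N1 entry_den_bounds.
have := @common_denominator_correct s1 n P1 (env_n E1) _ den_bd; rewrite -e2 => cap2.
have {}cap2 v : (v <= n)%N -> cell s2 aCap v%:Z =
    cell s1 aNum v%:Z * prod_others (fun u => entry_den (x u)) n v.
  move=> le_v; rewrite cap2 //; last by rewrite N1.
  by congr (_ * _); apply: eq_bigr => u _; rewrite Ds.
have cap2v v : (v < n)%N -> cell s2 aCap v%:Z = capacity v.
  by move=> lt_v; rewrite cap2 ?Ns // ltnW.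
have capD : cell s2 aCap n%:Z = denominator.
  rewrite cap2 // numn mul1r; apply: eq_bigr => u _.
  by rewrite ltn_eqF.
have inf3 : cell s3 vM 0 = infinity.
  rewrite e3 (@big_capacity_correct nA nB).
  - by congr (_ + _); apply: eq_bigr => j _; rewrite cap2v.
  - by rewrite (C2 vA isT).
  - by rewrite (C2 vB isT).
  - by rewrite b2 // N1.
have mat4 u v : (u < W)%N -> (v < W)%N -> mat s4 W u v = instance_network u v.
  move=> uW vW; rewrite e4 (@build_network_correct nA nB adjs _ s3 _ _ E3) //.
  - rewrite inf3; apply: eq_network => i lt_i.
    by rewrite (C3 aCap isT) cap2v.
  - by rewrite (C3 vA isT) (C2 vA isT).
  - by rewrite (C3 vB isT) (C2 vB isT).
  - by rewrite (C3 aR isT) (C2 aR isT).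
  - by rewrite I3 // I2.
have P4 : powers s4.
  by move=> k; rewrite b4 // b3 // b2 // (C4 aPw isT) (C3 aPw isT) (C2 aPw isT); apply: P1.
have N4 : bound s4 = N by rewrite b4 // b3 // b2.
have nN0 : (0 : int) <= 2 ^+ N - 1 by rewrite subr_ge0; apply: exprn_ege1.
have net0 := instance_network_ge0.
have [|||F1 G1] := max_flow_correct E4 P4.
- by rewrite N4.
- by move=> u v uW vW; rewrite mat4 ?net0.
- rewrite N4; apply: sink_cut => // u un; rewrite mat4 // ?n1 //.
  rewrite instance_network_to_sink; case: ifP => // /andP[_ lt_u].
  by have /andP[] := capacity_bounds lt_u.
rewrite -e5 in F1 G1; set r1 := mat s5 W in F1 G1.
have {}F1 : flow_le W n instance_network r1 by apply: (eq_flow_le (ltnSn n.+1) _ F1).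
have inf5 : cell s5 vM 0 = infinity by rewrite (C5 vM isT) (C4 vM isT).
have isp5 i : (i < n)%N -> (0 < cell s5 aIsp i%:Z) = prc i.
  move=> lt_i; rewrite (C5 aIsp isT) (C4 aIsp isT) (C3 aIsp isT) (C2 aIsp isT) isp1 //.
  by rewrite /prc /x; case: (_ == _).
have A5 : cell s5 vA 0 = nA%:Z.
  by rewrite (C5 vA isT) (C4 vA isT) (C3 vA isT) (C2 vA isT).
have mat6 u v : (u < W)%N -> (v < W)%N ->
    mat s6 W u v = with_supply nA n prc infinity r1 u v.
  move=> uW vW; rewrite e6 (enable_correct A5 E5 uW vW) inf5.
  by apply: eq_with_supply => i lt_i; rewrite isp5 // infA.
have N6 : bound s6 = N by rewrite b6 // b5.
have P6 : powers s6.
  by move=> k; rewrite N6 -N4 (C6 aPw isT) (C5 aPw isT); apply: P4.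
have [|||F2 G2] := max_flow_correct E6 P6.
- by rewrite N6.
- move=> u v uW vW; rewrite mat6 // /with_supply; case: ifP => _; first exact: ltW infinity_gt0.
  by case: F1 => r1_ge0 _ _ _; apply: r1_ge0.
(* The sink has no outgoing capacity, so the first flow has not raised any residual capacity into
   the sink, and the new supplies do not enter it. *)
- rewrite N6; apply: sink_cut => // u un; rewrite mat6 // ?n1 //.
  rewrite /with_supply ifF; last by clear; lia.
  have [r1_ge0 pairs _ _] := F1.
  have := pairs u n.+1 (n1 u un) (ltnSn _).
  rewrite instance_network_sink ?n1 // addr0 instance_network_to_sink.
  have := r1_ge0 n.+1 u (ltnSn _) (n1 u un).
  case: ifP => [/andP[_ lt_u]|_]; last by move: nN0; clear; lia.
  by have /andP[_] := capacity_bounds lt_u; clear; lia.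
rewrite -e7 in F2 G2; set r2 := mat s7 W in F2 G2.
split; first by rewrite b8 // b7.
exists r1, r2; split=> //.
  by apply: (eq_flow_le (ltnSn n.+1) _ F2).
rewrite e8 (write_prices_correct (s := s7) (nA := nA) (nB := nB) _ E7).
  rewrite O7 // O6 // O5 // O4 // O3 // O2 // O1 cat0s.
  have isp7 i : i \in iota 0 nA -> (0 < cell s7 aIsp i%:Z) = prc i.
    rewrite mem_iota add0n => /= lt_i.
    by rewrite (C7 aIsp isT) (C6 aIsp isT) isp5 // infA.
  rewrite (eq_in_filter isp7); congr flatten; apply: eq_map => i.
  by rewrite (C7 aCap isT) (C6 aCap isT) (C5 aCap isT) (C4 aCap isT) (C3 aCap isT) capD.
by rewrite (C7 vA isT) (C6 vA isT).
Qed.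

End Pricing.

(** * Optimality *)

(* Weak duality for the fractional matching [f] bounds every revenue by
   the cost of [Cinf] minus the least cost of a cover in which priceable
   vertices are free; the prices [p] attain this bound. *)
Section Certificate.
Variables (R : realFieldType) (V : finType) (e : rel V) (Vp : {set V}).
Variables (c p : V -> R) (f : V -> V -> R) (C0 Cinf : {set V}).
Let total := \sum_u \sum_v f u v.
Let load v := \sum_u (f v u + f u v).
Hypothesis f_ge0 : forall u v, 0 <= f u v.
Hypothesis f_edge : forall u v, ~~ e u v -> f u v = 0.
Hypothesis load_fixed : forall v, v \notin Vp -> load v <= c v.
Hypothesis load_price : forall v, v \in Vp -> load v = p v.
Hypothesis C0_cover : vertex_cover e C0.
Hypothesis C0_cost : \sum_(v in C0 :\: Vp) c v + \sum_(v in Vp) p v <= total.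
Hypothesis Cinf_cover : vertex_cover e Cinf.
Hypothesis Cinf_fixed : [disjoint Cinf & Vp].
Hypothesis Cinf_cost : \sum_(v in Cinf) c v <= total.

Lemma load_ge0 v : 0 <= load v.
Proof. by apply: sumr_ge0 => u _; apply: addr_ge0. Qed.

(** Summing loads over [C] counts [f u v] once for each endpoint in [C], hence at least once on
    every edge; elsewhere [f] vanishes. *)
Lemma load_cover C : vertex_cover e C -> total <= \sum_(v in C) load v.
Proof.
move=> /forallP covC.
have -> : \sum_(v in C) load v
    = \sum_u \sum_v ((if u \in C then f u v else 0) + (if v \in C then f u v else 0)).
  rewrite [RHS](eq_bigr (fun u => \sum_v (if u \in C then f u v else 0)
      + \sum_v (if v \in C then f u v else 0))); last by move=> u _; rewrite big_split.
  rewrite big_split /= [X in _ + X]exchange_big /= -big_split /= big_mkcond /=.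
  apply: eq_bigr => v _; case: (v \in C); last by rewrite !big1 // addr0.
  by rewrite -big_split.
apply: ler_sum => u _; apply: ler_sum => v _.
have /forallP/(_ v)/implyP := covC u.
have := f_ge0 u v; case: (boolP (e u v)) => [_ f0 /(_ isT)|/f_edge -> _ _].
  by case: (u \in C) => /=; case: (v \in C) => //=; rewrite ?addr0 ?add0r ?lerDl.
by rewrite !if_same addr0.
Qed.

Lemma cover_weight_ge C : vertex_cover e C -> total <= cover_weight Vp c p C.
Proof.
move=> /load_cover; rewrite (big_setID Vp) /= addrC => /le_trans; apply.
rewrite /cover_weight /cover_revenue lerD //.
  by apply: ler_sum => v; rewrite inE => /andP[nv _]; apply: load_fixed.
by apply: ler_sum => v; rewrite inE => /andP[_ vp]; rewrite load_price.
Qed.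

Let coverU C : vertex_cover e C -> vertex_cover e (C :|: Vp).
Proof.
move=> /forallP H; apply/forallP=> u; apply/forallP=> v; apply/implyP=> euv.
have /forallP/(_ v)/implyP/(_ euv) := H u.
by rewrite !inE => /orP[]->; rewrite ?orbT.
Qed.

Let weightU C : cover_weight Vp c p (C :|: Vp)
  = \sum_(v in C :\: Vp) c v + \sum_(v in Vp) p v.
Proof. by rewrite /cover_weight /cover_revenue setDUl setDv setU0 [C :|: Vp]setUC setUK. Qed.

Lemma certified_revenue_maximizing : revenue_maximizing e Vp c p.
Proof.
have p0 v : v \in Vp -> 0 <= p v by move=> vp; rewrite -load_price ?load_ge0.
have revU C : cover_revenue Vp p (C :|: Vp) = \sum_(v in Vp) p v.
  by rewrite /cover_revenue [C :|: Vp]setUC setUK.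
(* By [C0_cost] this cover weighs no more than [total], the lower bound for all covers. It contains
   every priceable vertex, so no tie can give more revenue. *)
have minU : min_cover e Vp c p (C0 :|: Vp).
  split=> [|D /cover_weight_ge]; first exact: coverU.
  by apply: le_trans; rewrite weightU.
split=> //; exists (C0 :|: Vp).
  split=> // D _; rewrite revU /cover_revenue [leRHS](big_setID D) /= setIC lerDl.
  by apply: sumr_ge0 => v; rewrite inE => /andP[_ /p0].
(* The fixed part of [D] plus its revenue under [q] is at most the cost of [Cinf], hence at most
   [total], hence at most the weight of [D :|: Vp] under [p]. That weight is the same fixed part
   plus the sum of the prices [p], and the fixed part cancels. *)
move=> q D q0 [[covD minD] _]; rewrite revU.
have := cover_weight_ge (coverU covD); rewrite weightU.
have := minD _ Cinf_cover; rewrite {1 2}/cover_weight /cover_revenue.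
have -> : Cinf :&: Vp = set0 by apply/eqP; rewrite setI_eq0.
have -> : Cinf :\: Vp = Cinf by apply/setDidPl.
rewrite big_set0 addr0; have := Cinf_cost; lra.
Qed.

End Certificate.

(** * Reading fractional matchings and vertex covers off a residual network *)

Section EdgeFlow.
Variables (nA nB : nat) (adjs : seq int).
Local Notation n := (nA + nB)%N.
Local Notation W := n.+2.
Let edge a b := 0 < nth 0 adjs (a * nB + b).

(** The reverse arc has no capacity of its own, so its residual capacity is the flow from [a] to
    [b]. *)
Definition edge_flow (r : nat -> nat -> int) (a b : nat) : int := r (nA + b)%N a.

Section Flow.
Variables (cap : nat -> int) (M : int) (r : nat -> nat -> int).
Hypothesis cap_r : flow_le W n (network nA nB adjs cap M) r.

Let r0 u v : (u < W)%N -> (v < W)%N -> 0 <= r u v.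
Proof. by case: cap_r => H _ _ _; apply: H. Qed.

Let pairs u v : (u < W)%N -> (v < W)%N ->
  r u v + r v u = network nA nB adjs cap M u v + network nA nB adjs cap M v u.
Proof. by case: cap_r => _ H _ _; apply: H. Qed.

(** By the pair sums each term is the net flow from [u] to [v]; this is conservation seen from the
    reverse arcs. *)
Let balance u : (u < n)%N ->
  \sum_(v < W) (r v u - network nA nB adjs cap M v u) = 0.
Proof.
move=> un; have uW : (u < W)%N by lia.
rewrite (eq_bigr (fun v : 'I_W => network nA nB adjs cap M u v - r u v)).
  rewrite sumrB; have [_ _ /(_ u uW) H _] := cap_r.
  by rewrite -[X in _ - X]/(out_residual W r u) H ?subrr //; lia.
by move=> v _; have := pairs uW (ltn_ord v); lia.
Qed.

Lemma big_vertices (F : nat -> int) :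
  \sum_(v < W) F v = \sum_(a < nA) F a + \sum_(b < nB) F (nA + b)%N + F n + F n.+1.
Proof. by rewrite !big_ord_recr /= big_split_ord. Qed.

Lemma network_edge a b : (a < nA)%N -> (b < nB)%N ->
  network nA nB adjs cap M a (nA + b) = if edge a b then M else 0.
Proof. by move=> an bn; rewrite /network ifT ?addKn //; lia. Qed.

Lemma network_supply a : (a < nA)%N -> network nA nB adjs cap M n a = cap a.
Proof. by move=> an; rewrite /network ifF; [rewrite ifT //|]; lia. Qed.

Lemma network_demand b : (b < nB)%N ->
  network nA nB adjs cap M (nA + b) n.+1 = cap (nA + b)%N.
Proof. by move=> bn; rewrite /network; do 2! [rewrite ifF; last by lia]; rewrite ifT //; lia. Qed.

Lemma network_none u v :
  ~~ [|| (u < nA)%N && (nA <= v < n)%N, (u == n) && (v < nA)%N |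
      (nA <= u < n)%N && (v == n.+1)] ->
  network nA nB adjs cap M u v = 0.
Proof. by rewrite !negb_or => /and3P[/negbTE c1 /negbTE c2 /negbTE c3]; rewrite /network c1 c2 c3. Qed.

Lemma edge_flow_pair a b : (a < nA)%N -> (b < nB)%N ->
  r a (nA + b) = (if edge a b then M else 0) - edge_flow r a b.
Proof.
move=> an bn; have := @pairs a (nA + b) ltac:(lia) ltac:(lia).
by rewrite network_edge // (@network_none (nA + b)) /edge_flow; lia.
Qed.

Lemma edge_flow_ge0 a b : (a < nA)%N -> (b < nB)%N -> 0 <= edge_flow r a b.
Proof. by move=> an bn; apply: r0; lia. Qed.

Lemma edge_flow_edge a b : (a < nA)%N -> (b < nB)%N -> ~~ edge a b ->
  edge_flow r a b = 0.
Proof.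
move=> an bn ne; have := edge_flow_pair an bn; rewrite (negbTE ne).
have := @r0 a (nA + b) ltac:(lia) ltac:(lia).
by have := edge_flow_ge0 an bn; lia.
Qed.

Let zero_pair u v : (u < W)%N -> (v < W)%N ->
  network nA nB adjs cap M u v = 0 -> network nA nB adjs cap M v u = 0 -> r u v = 0.
Proof.
move=> uW vW e1 e2; have := pairs uW vW; rewrite e1 e2.
by have := r0 uW vW; have := r0 vW uW; lia.
Qed.

Lemma edge_flow_out a : (a < nA)%N -> \sum_(b < nB) edge_flow r a b = r a n.
Proof.
move=> an; have aN : (a < n)%N by lia.
have := balance aN.
rewrite (big_vertices (fun v => r v a - network nA nB adjs cap M v a)).
have -> : \sum_(a' < nA) (r a' a - network nA nB adjs cap M a' a) = 0.
  apply: big1 => a' _; have := ltn_ord a' => an'.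
  have e1 : network nA nB adjs cap M a' a = 0 by apply: network_none; lia.
  have e2 : network nA nB adjs cap M a a' = 0 by apply: network_none; lia.
  by rewrite e1 zero_pair //; lia.
have -> : \sum_(b < nB) (r (nA + b)%N a - network nA nB adjs cap M (nA + b) a)
    = \sum_(b < nB) edge_flow r a b.
  apply: eq_bigr => b _; have := ltn_ord b => bn.
  by rewrite network_none ?subr0 //; lia.
rewrite network_supply // (@network_none n.+1); last by lia.
rewrite (@zero_pair n.+1 a) ?network_none //; try lia.
have := @pairs n a ltac:(lia) ltac:(lia).
by rewrite network_supply // (@network_none a n); lia.
Qed.

Lemma supply_pair a : (a < nA)%N -> r n a + r a n = cap a.
Proof.
move=> an; rewrite (@pairs n a); [|lia|lia].
by rewrite network_supply // network_none ?addr0 //; lia.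
Qed.

Lemma edge_flow_in b : (b < nB)%N -> \sum_(a < nA) edge_flow r a b = r n.+1 (nA + b).
Proof.
move=> bn; have bN : (nA + b < n)%N by lia.
have := balance bN.
rewrite (big_vertices (fun v => r v (nA + b)%N - network nA nB adjs cap M v (nA + b))).
have -> : \sum_(b' < nB) (r (nA + b')%N (nA + b)%N
    - network nA nB adjs cap M (nA + b') (nA + b)) = 0.
  apply: big1 => b' _; have := ltn_ord b' => bn'.
  have e1 : network nA nB adjs cap M (nA + b') (nA + b) = 0 by apply: network_none; lia.
  have e2 : network nA nB adjs cap M (nA + b) (nA + b') = 0 by apply: network_none; lia.
  by rewrite e1 zero_pair //; lia.
have -> : \sum_(a < nA) (r a (nA + b)%N - network nA nB adjs cap M a (nA + b))
    = - \sum_(a < nA) edge_flow r a b.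
  rewrite -sumrN; apply: eq_bigr => a _.
  by rewrite network_edge ?edge_flow_pair //; lia.
rewrite (@network_none n.+1); last by lia.
rewrite (@network_none n); last by lia.
rewrite (@zero_pair n (nA + b)) ?network_none //; try lia.
Qed.

Lemma demand_pair b : (b < nB)%N -> r n.+1 (nA + b) + r (nA + b) n.+1 = cap (nA + b)%N.
Proof.
move=> bn; rewrite (@pairs n.+1 (nA + b)); [|lia|lia].
by rewrite network_demand // network_none ?add0r //; lia.
Qed.

Let edge_flow_le a b : (a < nA)%N -> (b < nB)%N -> edge_flow r a b <= cap (nA + b)%N.
Proof.
move=> an bn; rewrite -demand_pair // -edge_flow_in // (bigD1 (Ordinal an)) //=.
rewrite -addrA lerDl; apply: addr_ge0; last by apply: r0; lia.
by apply: sumr_ge0 => a' _; apply: edge_flow_ge0.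
Qed.

Hypothesis cap_ge0 : forall b, (b < nB)%N -> 0 <= cap (nA + b)%N.
Hypothesis capM : \sum_(b < nB) cap (nA + b)%N < M.

(** The arc from [b] to the sink limits the flow on [ab]. Hence edges are never saturated, and no
    edge crosses a tight cut from the source side to the sink side. *)
Lemma edge_flow_lt a b : (a < nA)%N -> (b < nB)%N -> edge_flow r a b < M.
Proof.
move=> an bn; apply: le_lt_trans (edge_flow_le an bn) (le_lt_trans _ capM).
rewrite (bigD1 (Ordinal bn)) //= lerDl.
by apply: sumr_ge0 => b' _; apply: cap_ge0.
Qed.

Lemma edge_flow_out_lt a : (a < nA)%N -> r a n < M.
Proof.
move=> an; apply: le_lt_trans capM; rewrite -edge_flow_out //.
by apply: ler_sum => b _; apply: edge_flow_le.
Qed.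

(* A cut without residual capacity is a vertex cover of the same cost as the
   flow. *)
Lemma tight_cut S : is_cut n S -> cut_residual W S r <= 0 ->
  [/\ forall a b, (a < nA)%N -> (b < nB)%N -> edge a b -> S a || ~~ S (nA + b)%N,
      \sum_(a < nA | S a) cap a + \sum_(b < nB | ~~ S (nA + b)%N) cap (nA + b)%N
        = \sum_(a < nA) \sum_(b < nB) edge_flow r a b &
      forall a, (a < nA)%N -> S a -> cap a = r a n].
Proof.
move=> [Ss St] tight.
have zero u v : (u < W)%N -> (v < W)%N -> ~~ S u -> S v -> r u v = 0.
  move=> uW vW Su Sv; apply/eqP; rewrite eq_le r0 // andbT; apply: le_trans tight.
  rewrite /cut_residual (bigD1 (Ordinal uW)) //= (bigD1 (Ordinal vW)) //= -addrA lerDl.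
  apply: addr_ge0; last by apply: sumr_ge0 => u' _; apply: sumr_ge0 => v' _; apply: r0.
  by apply: sumr_ge0 => v' _; apply: r0.
have cover a b : (a < nA)%N -> (b < nB)%N -> edge a b -> S a || ~~ S (nA + b)%N.
  move=> an bn ab; apply/negPn; rewrite negb_or negbK; apply/andP=> -[Sa Sb].
  have := edge_flow_pair an bn; rewrite ab zero //; try lia.
  by have := edge_flow_lt an bn; lia.
have supply a : (a < nA)%N -> S a -> cap a = r a n.
  by move=> an Sa; rewrite -supply_pair // zero ?add0r //; lia.
split=> //.
rewrite big_mkcond [X in _ + X]big_mkcond /=.
rewrite (eq_bigr (fun a : 'I_nA => \sum_(b < nB) (if S a then edge_flow r a b else 0))).
  rewrite [X in _ + X](eq_bigr (fun b : 'I_nB =>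
      \sum_(a < nA) (if ~~ S (nA + b)%N then edge_flow r a b else 0))).
    rewrite [X in _ + X]exchange_big -big_split /=; apply: eq_bigr => a _.
    (* Each edge flow must be counted exactly once. If both endpoints are in the cover, the reverse
       arc crosses the tight cut and the flow is 0; if neither is, there is no edge and the flow is
       again 0. *)
    rewrite -big_split; apply: eq_bigr => b _ /=.
    have an := ltn_ord a; have bn := ltn_ord b.
    case: (boolP (S a)) => Sa; case: (boolP (S (nA + b)%N)) => Sb //=; rewrite ?addr0 ?add0r //.
      rewrite /edge_flow [r _ _]zero ?addr0 //; lia.
    rewrite edge_flow_edge //; apply/negP=> /(cover _ _ an bn).
    by rewrite Sb (negbTE Sa).
  move=> b _; have bn := ltn_ord b; case: ifP => Sb; last by rewrite big1.
  by rewrite edge_flow_in // -demand_pair // [r (nA + b)%N _]zero ?addr0 //; lia.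
move=> a _; case: ifP => Sa; last by rewrite big1.
by rewrite edge_flow_out // supply.
Qed.

End Flow.
End EdgeFlow.

(** * Instances *)

Lemma nth_allpairs_row (S T U : Type) (f : S -> T -> U) x0 y0 z0 s t a b :
  (a < size s)%N -> (b < size t)%N ->
  nth z0 [seq f x y | x <- s, y <- t] (a * size t + b) = f (nth x0 s a) (nth y0 t b).
Proof.
elim: s a => [|x s IH] [|a] //= lt_a lt_b.
  by rewrite nth_cat size_map mul0n add0n lt_b (nth_map y0).
rewrite nth_cat size_map ifF; last by apply/negbTE; rewrite mulSn -leqNgt -addnA leq_addr.
by rewrite mulSn -addnA addKn IH.
Qed.

Lemma up_log_bit_length z : (up_log 2 (pos_part z) <= bit_length z)%N.
Proof.
apply: up_log_min => //; apply: leq_trans (ltnW (trunc_log_ltn `|z| _)) => //.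
by rewrite /pos_part; case: ifP.
Qed.

Lemma input_size_cat x y : input_size (x ++ y) = (input_size x + input_size y)%N.
Proof. exact: big_cat. Qed.

Lemma input_size_flatten (T : Type) (f : T -> seq int) s :
  input_size (flatten (map f s)) = (\sum_(i <- s) input_size (f i))%N.
Proof.
elim: s => [|i s IH] /=; first by rewrite /input_size !big_nil.
by rewrite input_size_cat big_cons IH.
Qed.

Section Instance.
Variable I : bip_instance.
Local Notation n := (nA I + nB I)%N.
Local Notation Vp := (priceable I).

Definition entry_of (v : vertex I) : entry :=
  if v \in Vp then None else Some (numq (cost v), denq (cost v)).

Definition vertices : seq (vertex I) :=
  [seq inl i | i <- enum 'I_(nA I)] ++ [seq inr j | j <- enum 'I_(nB I)].

Definition entries : seq entry := map entry_of vertices.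

Definition adjacency : seq int :=
  [seq (((i, j) \in edges I) : nat)%:Z | i <- enum 'I_(nA I), j <- enum 'I_(nB I)].

Definition index_of (v : vertex I) : nat :=
  match v with inl a => a | inr b => (nA I + b)%N end.

Lemma encode_entries :
  encode I = (nA I)%:Z :: (nB I)%:Z :: flatten (map encode_entry entries) ++ adjacency.
Proof.
have E v : encode_vertex v = encode_entry (entry_of v).
  by rewrite /encode_vertex /entry_of; case: ifP.
have EE (T : Type) (g : T -> vertex I) l :
    [seq encode_vertex (g i) | i <- l]
    = map encode_entry (map entry_of (map g l)).
  by elim: l => //= i l ->; rewrite E.
by rewrite /encode /entries /vertices !map_cat flatten_cat -!catA -!EE.
Qed.

Lemma size_entries : size entries = n.
Proof. by rewrite size_map size_cat; congr addn; rewrite size_map size_enum_ord. Qed.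

Lemma index_of_lt v : (index_of v < n)%N.
Proof. by case: v => i /=; have := ltn_ord i; lia. Qed.

Lemma nth_entries v : nth None entries (index_of v) = entry_of v.
Proof.
have sv : size vertices = n by rewrite -(size_map entry_of) size_entries.
rewrite (nth_map v) ?sv ?index_of_lt //; congr entry_of.
rewrite nth_cat size_map size_enum_ord; case: v {sv} => i /=.
  by rewrite ltn_ord (nth_map i) ?size_enum_ord // nth_ord_enum.
by rewrite ltnNge leq_addr /= addKn (nth_map i) ?size_enum_ord // nth_ord_enum.
Qed.

Lemma index_of_surj i : (i < n)%N -> exists v, i = index_of v.
Proof.
move=> lt_i; case: (ltnP i (nA I)) => [lt_A|le_A].
  by exists (inl (Ordinal lt_A)).
have lt_B : (i - nA I < nB I)%N by lia.
by exists (inr (Ordinal lt_B)); rewrite /= subnKC.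
Qed.

Lemma entries_den i : (i < n)%N -> 0 < entry_den (nth None entries i).
Proof.
by case/index_of_surj=> v ->; rewrite nth_entries /entry_of; case: ifPn => //= nv.
Qed.

Lemma entries_priceable v : (nth None entries (index_of v) == None) = (v \in Vp).
Proof. by rewrite nth_entries /entry_of; case: ifP. Qed.

Lemma adjacency_nth (a : 'I_(nA I)) (b : 'I_(nB I)) :
  (0 < nth 0 adjacency (a * nB I + b)) = ((a, b) \in edges I).
Proof.
rewrite -{1}[nB I]size_enum_ord (nth_allpairs_row _ a b) ?size_enum_ord //.
by rewrite !nth_ord_enum; case: (_ \in _).
Qed.

(** The flag of a vertex pays for the vertex, its numerator and denominator for the digits, and the
    two leading sizes for source and sink. *)
Lemma input_size_encode : (2 + n + \sum_(x <- entries) entry_bits x <= input_size (encode I))%N.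
Proof.
rewrite encode_entries -cat1s -(cat1s (nB I)%:Z) !input_size_cat input_size_flatten.
have one z : (1 <= input_size [:: z])%N by rewrite /input_size big_seq1.
have : (n + \sum_(x <- entries) entry_bits x <= \sum_(x <- entries) input_size (encode_entry x))%N.
  have -> : n = (\sum_(x <- entries) 1)%N by rewrite sum1_size size_entries.
  rewrite -big_split /=; apply: leq_sum => -[[p q]|] _ /=; last exact: one.
  rewrite /input_size !big_cons big_nil.
  have := up_log_bit_length p; have := up_log_bit_length q; rewrite /bit_length; lia.
by have := one (nA I)%:Z; have := one (nB I)%:Z; lia.
Qed.

Local Notation D := (denominator (nA I) (nB I) entries).
Local Notation cap := (capacity (nA I) (nB I) entries).
Local Notation M := (infinity (nA I) (nB I) entries).

Lemma cost_capacity v : v \notin Vp -> cost v = (cap (index_of v))%:~R / D%:~R.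
Proof.
move=> nv; have D0 := denominator_gt0 entries_den.
have DE : D = denq (cost v) * prod_others (fun u => entry_den (nth None entries u)) n (index_of v).
  rewrite /denominator (bigD1 (Ordinal (index_of_lt v))) //= nth_entries /entry_of (negbTE nv).
  congr (_ * _); rewrite /prod_others [RHS](bigD1 (Ordinal (index_of_lt v))) //= eqxx mul1r.
  apply: eq_bigr => u ne.
  have -> : (u == index_of v :> nat) = false; last by [].
  by apply: contraNF ne => /eqP uv; apply/eqP/val_inj.
rewrite /capacity nth_entries /entry_of (negbTE nv) /=.
apply: (canRL (mulfK _)); first by rewrite intr_eq0 gt_eqF.
rewrite DE !intrM mulrA; congr (_ * _).
by rewrite -{1}[cost v]divq_num_den mulfVK // intr_eq0 denq_neq0.
Qed.

Hypothesis priceableA : priceable I \subset sideA I.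

Lemma priceable_inr b : (inr b : vertex I) \notin Vp.
Proof. by apply: contraL priceableA => vp; apply/subsetPn; exists (inr b); rewrite ?inE. Qed.

Lemma enum_priceable :
  enum Vp = [seq (inl i : vertex I) | i <- enum 'I_(nA I) & (inl i : vertex I) \in Vp].
Proof.
have -> : enum Vp = filter (mem Vp) vertices.
  (* The canonical enumeration of a sum type lists the left summand first, which is the order of
     [vertices]. *)
  rewrite /vertices !enumT {1}/enum_mem; congr filter.
  by rewrite [in LHS]unlock.
rewrite filter_cat !filter_map [X in _ ++ X](_ : _ = [::]) ?cats0 //.
rewrite (eq_filter (a2 := pred0)) ?filter_pred0 // => b.
by apply/negbTE/priceable_inr.
Qed.

Hypothesis cost_ge0 : forall v : vertex I, v \notin priceable I -> 0 <= cost v.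

Lemma entries_num i : (i < n)%N -> 0 <= entry_num (nth None entries i).
Proof.
case/index_of_surj=> v ->; rewrite nth_entries /entry_of; case: ifPn => //= nv.
by rewrite numq_ge0 cost_ge0.
Qed.

Section Solution.
Variables (R : realType) (r1 r2 : nat -> nat -> int).
Let prc : pred nat := fun i => nth None entries i == None.
Hypothesis flow1 : flow_le n.+2 n (instance_network (nA I) (nB I) entries adjacency) r1.
Hypothesis cut1 : good_cut n 0 r1.
Hypothesis flow2 : flow_le n.+2 n (with_supply (nA I) n prc M r1) r2.
Hypothesis cut2 : good_cut n 0 r2.

Definition price_of (v : vertex I) : rat := (r2 (index_of v) n)%:~R / D%:~R.

Let capP v := if prc v then M else cap v.

Let prcE v : prc (index_of v) = (v \in Vp).
Proof. exact: entries_priceable. Qed.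

Let cap_ge0 v : (v < n)%N -> 0 <= cap v.
Proof.
by move=> vn; have /andP[] := capacity_bounds size_entries entries_num entries_den vn.
Qed.

Let capM : \sum_(b < nB I) cap (nA I + b) < M.
Proof. by rewrite /infinity ltrDr. Qed.

Let prcB b : (b < nB I)%N -> prc (nA I + b) = false.
Proof.
by move=> bn; have := prcE (inr (Ordinal bn)); rewrite (negbTE (priceable_inr _)).
Qed.

Let capPB b : (b < nB I)%N -> capP (nA I + b) = cap (nA I + b).
Proof. by move=> bn; rewrite /capP prcB. Qed.

Let cap_prc a : prc a -> cap a = 0.
Proof. by rewrite /prc /capacity => /eqP ->; rewrite mul0r. Qed.

Let cap1_ge0 b : (b < nB I)%N -> 0 <= cap (nA I + b).
Proof. by move=> bn; apply: cap_ge0; rewrite ltn_add2l. Qed.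

Let r1_prc a : (a < nA I)%N -> prc a -> r1 a n = 0.
Proof.
move=> an pa; have [H _ _ _] := flow1.
have := supply_pair flow1 an; rewrite cap_prc //.
by have := H a n ltac:(lia) ltac:(lia); have := H n a ltac:(lia) ltac:(lia); lia.
Qed.

(** The first flow sends nothing through priceable vertices, so raising their supply before it or
    after it gives the same matrix. Thus both runs together form a single flow in the network with
    supply [M] at the priceable vertices. *)
Let flowP : flow_le n.+2 n (network (nA I) (nB I) adjacency capP M) r2.
Proof.
have [H B C E] := flow1.
have netE u v : network (nA I) (nB I) adjacency capP M u v
    = with_supply (nA I) n prc M (instance_network (nA I) (nB I) entries adjacency) u v.
  rewrite /with_supply /instance_network /network /capP.
  case: (boolP ((u < nA I)%N && _)) => [c1|_]; first by rewrite [RHS]ifF //; lia.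
  case: (boolP ((u == n) && (v < nA I)%N)) => [/andP[-> ->]|ne] /=; first by case: ifP.
  rewrite [RHS]ifF; last by lia.
  case: ifP => // /andP[/andP[le_u lt_u] _].
  have -> : u = (nA I + (u - nA I))%N by lia.
  by rewrite prcB //; lia.
apply: flow_le_trans flow2; split.
- move=> u v uW vW; rewrite /with_supply; case: ifP => _; last exact: H.
  by apply: ltW; apply: infinity_gt0 size_entries entries_num entries_den.
- have supE v : (v < nA I)%N -> prc v ->
      r1 v n = instance_network (nA I) (nB I) entries adjacency v n.
    by move=> vn pv; rewrite r1_prc // /instance_network network_none //; lia.
  have ne v : (v < nA I)%N -> (v == n) = false by lia.
  move=> u v uW vW; rewrite !netE /with_supply.
  case: (boolP [&& u == n, _ & _]) => [/and3P[/eqP-> vn pv]|_].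
    by rewrite ne //= supE.
  case: (boolP [&& v == n, _ & _]) => [/and3P[/eqP-> un pu]|_]; last exact: B.
  by rewrite supE.
- move=> u uW us ut.
  transitivity (out_residual n.+2 r1 u).
    by apply: eq_bigr => v _; rewrite /with_supply (negbTE us).
  by rewrite C //; apply: eq_bigr => v _; rewrite netE /with_supply (negbTE us).
- move=> u uW; rewrite netE /with_supply !ifF; try lia.
  exact: E.
Qed.

Let F (a : 'I_(nA I)) (b : 'I_(nB I)) : int := edge_flow (nA I) r2 a b.

Let Q (z : int) : R := z%:~R / D%:~R.

Let D_gt0 : (0 : R) < D%:~R.
Proof. by rewrite ltr0z; apply: denominator_gt0 entries_den. Qed.

Let Q_le y z : y <= z -> Q y <= Q z.
Proof. by move=> le_yz; rewrite ler_pM2r ?invr_gt0 // ler_int. Qed.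

Let QD y z : Q (y + z) = Q y + Q z.
Proof. by rewrite /Q intrD mulrDl. Qed.

Let Q_sum (J : finType) (P : pred J) (g : J -> int) :
  Q (\sum_(j | P j) g j) = \sum_(j | P j) Q (g j).
Proof. by rewrite /Q rmorph_sum /= mulr_suml. Qed.

Let ratrQ z : ratr (z%:~R / D%:~R) = Q z.
Proof. by rewrite fmorph_div /= !ratr_int. Qed.

Let ratr_cost v : v \notin Vp -> ratr (cost v) = Q (cap (index_of v)).
Proof. by move=> nv; rewrite cost_capacity // ratrQ. Qed.

Definition fractional_matching (u v : vertex I) : R :=
  match u, v with inl a, inr b => Q (F a b) | _, _ => 0 end.

Definition cover_of_cut (S : pred nat) : {set vertex I} :=
  [set v : vertex I | match v with inl a => S a | inr b => ~~ S (nA I + b)%N end].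

(** The certificate consists of the final flow as fractional matching, the first cut as the cover
    for free priceable vertices, and the second cut as the cover that avoids them. *)
Lemma price_of_optimal :
  revenue_maximizing (adj I) Vp (fun v => ratr (cost v) : R) (fun v => ratr (price_of v)).
Proof.
have [S1 Sc1 T1] := cut1; have [S2 Sc2 T2] := cut2.
have capP_ge0 b : (b < nB I)%N -> 0 <= capP (nA I + b).
  by move=> bn; rewrite capPB ?cap1_ge0.
have capPM : \sum_(b < nB I) capP (nA I + b) < M.
  by rewrite (eq_bigr _ (fun b _ => capPB (ltn_ord b))).
have [cov1 cost1 sat1] := tight_cut flow1 cap1_ge0 capM Sc1 T1.
have [cov2 cost2 sat2] := tight_cut flowP capP_ge0 capPM Sc2 T2.
have edgeE (a : 'I_(nA I)) (b : 'I_(nB I)) :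
  (0 < nth 0 adjacency (a * nB I + b)) = adj I (inl a) (inr b) by apply: adjacency_nth.
have coverE S : (forall a b, (a < nA I)%N -> (b < nB I)%N ->
    0 < nth 0 adjacency (a * nB I + b) -> S a || ~~ S (nA I + b)%N) ->
    vertex_cover (adj I) (cover_of_cut S).
  move=> cov; apply/forallP=> -[a|b]; apply/forallP=> -[a'|b'] //=.
  by apply/implyP=> ab; rewrite !inE cov // adjacency_nth.
(* A priceable vertex on the sink side of the tight cut would have its supply [M] saturated. *)
have S2_prc (a : 'I_(nA I)) : S2 a -> prc a = false.
  move=> Sa; apply/negP=> pa; have := sat2 a (ltn_ord a) Sa.
  rewrite /capP pa; have := edge_flow_out_lt flowP capPM (ltn_ord a); lia.
have total : \sum_u \sum_v fractional_matching u v = Q (\sum_(a < nA I) \sum_(b < nB I) F a b).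
  rewrite big_sumType /= [X in _ + X]big1 ?addr0; last first.
    by move=> b _; rewrite big1 //; case.
  rewrite Q_sum; apply: eq_bigr => a _.
  by rewrite big_sumType /= big1 ?add0r ?Q_sum.
have loadA a : \sum_u (fractional_matching (inl a) u + fractional_matching u (inl a))
    = Q (r2 a n).
  rewrite big_sumType /= big1 => [|a' _]; rewrite ?addr0 // add0r.
  rewrite -(edge_flow_out flowP) // Q_sum; apply: eq_bigr => b _; exact: addr0.
have loadB b : \sum_u (fractional_matching (inr b) u + fractional_matching u (inr b))
    = Q (r2 n.+1 (nA I + b)%N).
  rewrite big_sumType /= addrC big1 => [|b' _]; rewrite ?addr0 // add0r.
  rewrite -(edge_flow_in flowP) // Q_sum; apply: eq_bigr => a _; exact: add0r.
have [r2_ge0 _ _ mono2] := flow2.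
apply: (@certified_revenue_maximizing _ _ _ _ _ _ fractional_matching
          (cover_of_cut S1) (cover_of_cut S2)).
- move=> [a|b] [a'|b'] //=; rewrite -[0](_ : Q 0 = 0); last by rewrite /Q mul0r.
  by apply: Q_le; apply: (edge_flow_ge0 flowP).
- move=> [a|b] [a'|b'] //= ne; rewrite /F (edge_flow_edge flowP) ?adjacency_nth //.
  by rewrite /Q mul0r.
- move=> [a|b] nv; rewrite ratr_cost //.
    rewrite loadA; apply: Q_le.
    have := supply_pair flowP (ltn_ord a); rewrite /capP.
    have := prcE (inl a); rewrite (negbTE nv) /= => ->.
    have := r2_ge0 n a ltac:(lia) ltac:(have := ltn_ord a; lia); lia.
  rewrite loadB; apply: Q_le.
  have := demand_pair flowP (ltn_ord b); rewrite capPB //=.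
  have := r2_ge0 (nA I + b)%N n.+1 ltac:(have := ltn_ord b; lia) ltac:(lia); lia.
- move=> [a|b] vp; last by have := priceable_inr b; rewrite vp.
  by rewrite loadA ratrQ.
- exact: coverE cov1.
- rewrite total.
  have -> : \sum_(v in cover_of_cut S1 :\: Vp) ratr (cost v) =
      Q (\sum_(a < nA I | S1 a && ~~ prc a) cap a
         + \sum_(b < nB I | ~~ S1 (nA I + b)%N) cap (nA I + b)).
    rewrite big_sumType QD !Q_sum /=; congr (_ + _).
      apply: eq_big => [a|a]; first by rewrite !inE -prcE andbC.
      by rewrite !inE => /andP[nv _]; rewrite ratr_cost.
    apply: eq_big => [b|b]; first by rewrite !inE priceable_inr.
    by rewrite !inE => /andP[nv _]; rewrite ratr_cost.
  have -> : \sum_(v in Vp) ratr (price_of v) = Q (\sum_(a < nA I | prc a) r2 a n).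
    rewrite big_sumType /= [X in _ + X]big_pred0 ?addr0 => [|b]; last first.
      exact/negbTE/priceable_inr.
    by rewrite Q_sum; apply: eq_big => [a|a _]; [rewrite -prcE | rewrite ratrQ].
  rewrite -QD; apply: Q_le.
  have -> : \sum_(a < nA I | S1 a && ~~ prc a) cap a = \sum_(a < nA I | S1 a) cap a.
    rewrite [RHS](bigID (fun a : 'I_(nA I) => prc a)) /= [X in _ = X + _]big1 ?add0r // => a /andP[_].
    exact: cap_prc.
  (* The cost of the first cover equals the value of the first flow, all of it through fixed-price
     vertices. The second flow carries at least as much through each of these, by [mono2], and
     exactly the prices through the priceable ones. *)
  rewrite cost1 (bigID (fun a : 'I_(nA I) => prc a)) /= big1 ?add0r; last first.
    by move=> a pa; rewrite (edge_flow_out flow1) // r1_prc.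
  rewrite [leRHS](bigID (fun a : 'I_(nA I) => prc a)) /= addrC lerD //; last first.
    by apply: ler_sum => a _; rewrite (edge_flow_out flowP).
  apply: ler_sum => a _; rewrite (edge_flow_out flowP) // (edge_flow_out flow1) //.
  have := mono2 a ltac:(have := ltn_ord a; lia).
  by rewrite /with_supply ifF //; have := ltn_ord a; lia.
- exact: coverE cov2.
- rewrite disjoints_subset; apply/subsetP=> -[a|b]; rewrite !inE => Sv.
    by rewrite -prcE /= S2_prc.
  exact: priceable_inr.
- rewrite total -cost2.
  rewrite big_sumType QD !Q_sum /= le_eqVlt; apply/orP; left; apply/eqP; congr (_ + _).
    apply: eq_big => [a|a]; first by rewrite !inE.
    rewrite !inE => /S2_prc pa; rewrite ratr_cost /capP ?pa //.
    by rewrite -prcE /= pa.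
  apply: eq_big => [b|b _]; first by rewrite !inE.
  by rewrite ratr_cost ?priceable_inr // capPB.
Qed.

End Solution.
End Instance.

Theorem theorem4p1 (R : realType) :
  exists (P : program) (k : nat),
    forall I : bip_instance,
      (forall v : vertex I, v \notin priceable I -> 0 <= cost v) ->
      priceable I \subset sideA I ->
      exists (y : seq int) (p : vertex I -> rat),
        halts_within P (encode I) (input_size (encode I) ^ k + k)%N y /\
        encodes_prices p y /\
        revenue_maximizing (adj I) (priceable I)
          (fun v => ratr (cost v) : R) (fun v => ratr (p v)).
Proof.
(* The final loop bound is twice the number of network vertices plus the digits of the costs, hence
   at most twice the input size. *)
have [P [k Pk]] := polynomial_time pricing 2.
exists P, k => I cost_ge0 priceableA.
have [] := pricing_correct (adjacency I) (size_entries I)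
  (entries_num (I := I) cost_ge0) (@entries_den I).
rewrite -encode_entries => bd [r1 [r2 [flow1 cut1 flow2 cut2 out_eq]]].
have le_size := input_size_encode I.
exists (output (sem pricing (start (encode I)))), (price_of r2); split.
  by apply: Pk; [lia | rewrite bd; lia].
split; last exact: price_of_optimal flow1 cut1 flow2 cut2.
exists (fun v => r2 (index_of v) (nA I + nB I)%N),
  (fun=> denominator (nA I) (nB I) (entries I)).
split=> [v _|]; first by split=> //; apply: denominator_gt0 (@entries_den I).
rewrite out_eq enum_priceable //; congr flatten.
have iotaE : iota 0 (nA I) = map val (enum 'I_(nA I)) by rewrite val_enum_ord.
rewrite iotaE filter_map -!map_comp.
have -> : [seq i <- enum 'I_(nA I) | preim val (fun i => nth None (entries I) i == None) i]
  = [seq i <- enum 'I_(nA I) | (inl i : vertex I) \in priceable I].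
  by apply: eq_filter => i /=; rewrite -(entries_priceable (inl i)).
by apply: eq_map => i.
Qed.
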